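(* Let the $2n$-sphere $S^{2n}$ be endowed with its usual metric, let $*$ be the induced Hodge operator on $\Omega(S^{2n}_\theta)$, and let $e\in M_{2^n}(C_{\mathrm{alg}}(S^{2n}_\theta))\subset M_{2^n}(\Omega^0(S^{2n}_\theta))$ be the hermitian projection $$e=\tfrac12\Big(\mathbf 1+\sum_{\mu=1}^n(\Gamma^{\mu*}u^\mu+\Gamma^\mu u^{\mu*})+\gamma u\Big).$$ Then $e$ satisfies the self-duality equation $*\,e(de)^n=i^n\,e(de)^n$.
   Context: $n\ge2$, $\theta\in M_n(\mathbb{R})$ antisymmetric, $\lambda^{\mu\nu}=e^{i\theta_{\mu\nu}}$. $C_{\mathrm{alg}}(S^{2n}_\theta)$: unital $*$-algebra generated by $u^\mu,u^{\mu*}$ ($1\le\mu\le n$) and a central hermitian $u$ with relations $u^\mu u^\nu=\lambda^{\mu\nu}u^\nu u^\mu$, $u^{\mu*}u^{\nu*}=\lambda^{\mu\nu}u^{\nu*}u^{\mu*}$, $u^{\mu*}u^\nu=\lambda^{\nu\mu}u^\nu u^{\mu*}$, $\sum_\mu u^\mu u^{\mu*}+u^2=\mathbf 1$. $\mathrm{Cliff}(\mathbb{R}^{2n}_\theta)\cong M_{2^n}(\mathbb{C})$: unital $*$-algebra generated by $\Gamma^\mu,\Gamma^{\mu*}=(\Gamma^\mu)^*$ with $\Gamma^\mu\Gamma^\nu+\lambda^{\nu\mu}\Gamma^\nu\Gamma^\mu=0$, $\Gamma^{\mu*}\Gamma^{\nu*}+\lambda^{\nu\mu}\Gamma^{\nu*}\Gamma^{\mu*}=0$,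 $\Gamma^{\mu*}\Gamma^\nu+\lambda^{\mu\nu}\Gamma^\nu\Gamma^{\mu*}=\delta^{\mu\nu}\mathbf 1$, identified with $M_{2^n}(\mathbb{C})$ through its irreducible $*$-representation; $\gamma=\prod_{\mu=1}^n[\Gamma^{\mu*},\Gamma^\mu]$. Differential forms. $T^n=\mathbb{R}^n/\mathbb{Z}^n$ acts on $S^{2n}\subset\mathbb{C}^n\times\mathbb{R}$ by $\sigma_s(u^\mu_{(0)})=e^{2\pi is_\mu}u^\mu_{(0)}$, $\sigma_s(u)=u$ on the classical coordinates $u^\mu_{(0)},u$, and hence on $\Omega(S^{2n})$ (complex smooth forms). $C^\infty(T^n_\theta)$ is the algebra of smooth functions on the noncommutative torus (rapidly decreasing series in unitaries $U^1,\dots,U^n$ with $U^\mu U^\nu=\lambda^{\mu\nu}U^\nu U^\mu$) with action $\tau_s(U^\mu)=e^{2\pi is_\mu}U^\mu$. $\Omega(S^{2n}_\theta)=\big(\Omega(S^{2n})\widehat\otimes C^\infty(T^n_\theta)\big)^{\sigma\times\tau^{-1}}$ is the graded-involutive differential algebra of elements fixed by $\sigma_s\otimes\tau_{-s}$ for all $s\in T^n$, with differential $d$ the restriction of $d\otimes I$. $C_{\mathrm{alg}}(S^{2n}_\theta)$ is embedded in $\Omega^0(S^{2n}_\theta)=C^\infty(S^{2n}_\theta)$ by $u^\mu\mapsto u^\mu_{(0)}\otimes U^\mu$, $u\mapsto u\otimes\mathbf 1$. The Hodge operator of the round metric on $\Omega(S^{2n})$ commutes with the $\sigma_s$, and $*$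 on $\Omega(S^{2n}_\theta)$ is the restriction of $*\otimes I$, extended to matrices entrywise. Orientation convention: $S^{2n}$ is oriented so that the classical projection $P_+=e|_{\theta=0}$ satisfies the classical self-duality equation $*P_+(dP_+)^n=i^nP_+(dP_+)^n$ (this holds for one of the two orientations). *)

(* Defs.v *)
From HB Require Import structures.
From mathcomp Require Import all_boot all_order all_algebra.
From mathcomp Require Import all_classical all_reals all_analysis.
From mathcomp Require Import summability.
From mathcomp Require Import complex.

Set Implicit Arguments.
Unset Strict Implicit.
Unset Printing Implicit Defensive.

Import Order.TTheory GRing.Theory Num.Theory numFieldNormedType.Exports.

Local Open Scope ring_scope.
Local Open Scope complex_scope.

(** * Exterior algebra *)

Section Exterior.
Variables (R : realType) (N : nat).

(* A complex-valued alternating form on R^N, given by its coefficients on the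
   monomials dx_S = dx_{i_1} /\ ... /\ dx_{i_p}, S = {i_1 < ... < i_p}. *)
Definition ext := {set 'I_N} -> R[i].
HB.instance Definition _ := GRing.Lmodule.copy ext ({set 'I_N} -> R[i]).

(* dx_A /\ dx_B = shuffle_sign A B * dx_(A :|: B) for disjoint A and B *)
Definition shuffle_sign (A B : {set 'I_N}) : R[i] :=
  (-1) ^+ #|[set p : 'I_N * 'I_N | [&& p.1 \in A, p.2 \in B & (p.2 < p.1)%N]]|.

Definition ext_one : ext := fun S => (S == finset.set0)%:R.

Definition wedge (a b : ext) : ext := fun S =>
  \sum_(A : {set 'I_N} | A \subset S)
     shuffle_sign A (S :\: A) * a A * b (S :\: A).

(* interior product with the vector x *)
Definition contract (x : 'rV[R]_N) (a : ext) : ext := fun S =>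
  \sum_(i < N | i \notin S) shuffle_sign [set i] S * (x 0 i)%:C * a (i |: S).

(* pull-back of dx_T by the linear map x |-> x *m M *)
Definition lin_pull (M : 'M[R]_N) (T : {set 'I_N}) : ext :=
  foldr wedge ext_one
    [seq (fun S => \sum_(i < N | S == [set i]) (M i j)%:C) | j <- enum T].

End Exterior.

(** * Complex functions of real variables *)

Section ComplexCalculus.
Variables (R : realType) (N : nat).

Definition partial (i : 'I_N) (f : 'rV[R]_N -> R[i]) : 'rV[R]_N -> R[i] :=
  fun y => 'D_(delta_mx 0 i) (fun z => complex.Re (f z)) y
       +i* 'D_(delta_mx 0 i) (fun z => complex.Im (f z)) y.

Definition partials (s : seq 'I_N) (f : 'rV[R]_N -> R[i]) := foldr partial f s.

Definition cdifferentiable (f : 'rV[R]_N -> R[i]) (y : 'rV[R]_N) :=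
  differentiable (fun z => complex.Re (f z)) y /\
  differentiable (fun z => complex.Im (f z)) y.

End ComplexCalculus.

(** * Forms on the unit sphere of R^N *)

Section Sphere.
Variables (R : realType) (N : nat).

Definition sqnorm (x : 'rV[R]_N) : R := \sum_(i < N) x 0 i ^+ 2.

Definition sphere := {x : 'rV[R]_N | sqnorm x == 1}.

(* Since R^N = T_x S (+) R x, an alternating form on T_x S is identified with
   the form on R^N which restricts to it and is annihilated by contract x. *)
Definition form := sphere -> ext R N.
HB.instance Definition _ := GRing.Lmodule.copy form (sphere -> ext R N).

Definition form_mul (w1 w2 : form) : form := fun x => wedge (w1 x) (w2 x).

Definition form_conj (w : form) : form := fun x S => (w x S)^*.

Definition form_fun (f : sphere -> R[i]) : form :=
  fun x S => f x * ext_one R S.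

(* The pull-back r^* w to R^N minus the origin, r y = y / |y|. The differential
   of r at y is |y|^-1 times the orthogonal projection onto T_(r y) S, so r^*
   multiplies the coefficients of a p-form by |y|^-p. *)
Definition radial (w : form) (y : 'rV[R]_N) : ext R N := fun S =>
  if insub ((Num.sqrt (sqnorm y))^-1 *: y) is Some x
  then ((Num.sqrt (sqnorm y)) ^- #|S|)%:C * w x S else 0.

(* d w is the restriction to the sphere of the Euclidean differential of r^* w
   (which is r^* (d w)). *)
Definition form_d (w : form) : form := fun x S =>
  \sum_(i in S) shuffle_sign R [set i] (S :\ i) *
     partial i (fun y => radial w y (S :\ i)) (val x).

Definition smooth_form (w : form) : Prop :=
  (forall x, contract (val x) (w x) = 0) /\
  (forall S s y, y != 0 ->
     cdifferentiable (partials s (fun z => radial w z S)) y).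

Definition of_degree (p : nat) (w : form) : Prop :=
  forall x (S : {set 'I_N}), #|S| != p -> w x S = 0.

(* pull-back by the linear isometry x |-> x *m M *)
Definition form_pull (M : 'M[R]_N) (w : form) : form := fun x S =>
  \sum_(T : {set 'I_N}) radial w (val x *m M) T * lin_pull M T S.

(* Riemannian volume form of the sphere: the contraction of dx_0 /\ ... /\ dx_(N-1)
   with the outer unit normal x, up to the orientation o. *)
Definition volume (o : bool) (x : sphere) : ext R N := fun S =>
  (-1) ^+ o * \sum_(i < N | S == [set~ i]) (-1) ^+ i * (val x 0 i)%:C.

(* ( * w)_{j_1 ... j_q} = 1/p! sum w^{i_1 ... i_p} vol_{i_1 ... i_p j_1 ... j_q},
   so that a /\ * w = <a, w> vol; extended C-linearly to complex forms. *)
Definition form_hodge (o : bool) (w : form) : form := fun x T =>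
  \sum_(S : {set 'I_N} | [disjoint S & T])
     w x S * shuffle_sign R S T * volume o x (S :|: T).

End Sphere.

(** * Forms with coefficients in the noncommutative torus *)

Section NCTorus.
Variables (R : realType) (n : nat).

Definition lam (theta : 'M[R]_n) (mu nu : 'I_n) : R[i] :=
  cos (theta mu nu) +i* sin (theta mu nu).

(* With U^k = (U^1)^(k_1) ... (U^n)^(k_n) for k in Z^n, the relations
   U^mu U^nu = lam mu nu U^nu U^mu give U^k U^l = cocycle k l U^(k+l). *)
Definition cocycle (theta : 'M[R]_n) (k l : 'rV[int]_n) : R[i] :=
  \prod_(mu < n) \prod_(nu < n | (nu < mu)%N)
     lam theta mu nu ^ (k 0 mu * l 0 nu).

(* S^2n is the unit sphere of R^(2n+1) = C^n x R, with coordinates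
   (Re u^1, ..., Re u^n, Im u^1, ..., Im u^n, u). *)
Notation N := (n + n + 1)%N.

(* A family a stands for the series \sum_k a_k (x) U^k. The completed tensor
   product of forms with the smooth functions on the noncommutative torus
   consists of the families satisfying [tensor_hat] below; the operations
   are defined on all families. *)
Definition nc_form := 'rV[int]_n -> form R N.
HB.instance Definition _ := GRing.Lmodule.copy nc_form ('rV[int]_n -> form R N).

Definition pure (w : form R N) (k : 'rV[int]_n) : nc_form :=
  fun m => if m == k then w else 0.

(* [sum] is unconditional summation, here over Z^n. *)
Definition nc_mul (theta : 'M[R]_n) (a b : nc_form) : nc_form := fun m x S =>
  sum (fun k : 'rV[int]_n =>
    cocycle theta k (m - k) * form_mul (a k) (b (m - k)) x S : R[i]^o).

(* (w (x) U^k)^* = conj w (x) (U^k)^-1, and (U^k)^-1 is U^(-k) divided by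
   cocycle k (-k). *)
Definition nc_star (theta : 'M[R]_n) (a : nc_form) : nc_form := fun m =>
  (cocycle theta (- m) m)^-1 *: form_conj (a (- m)).

Definition nc_d (a : nc_form) : nc_form := fun m => form_d (a m).

Definition nc_hodge (o : bool) (a : nc_form) : nc_form :=
  fun m => form_hodge o (a m).

(* coefficientwise rapid decay for every seminorm of the Frechet space of
   smooth forms *)
Definition tensor_hat (a : nc_form) : Prop :=
  (forall k, smooth_form (a k)) /\
  (forall S s (q : nat), exists B : R[i], forall k (x : sphere R N),
     `|partials s (fun y => radial (a k) y S) (val x)|
       * (1 + \sum_(mu < n) `|k 0 mu|)%:~R ^+ q <= B).

(* u^mu |-> e^(2 i pi s_mu) u^mu, acting on row vectors from the right *)
Definition rotation (s : 'rV[R]_n) : 'M[R]_N :=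
  let c := diag_mx (\row_mu cos (2 * pi * s 0 mu)) in
  let z := diag_mx (\row_mu sin (2 * pi * s 0 mu)) in
  block_mx (block_mx c z (- z) c) 0 0 1%:M.

(* sigma_s (x) tau_(-s) *)
Definition torus_act (s : 'rV[R]_n) (a : nc_form) : nc_form := fun k =>
  let t := - (2 * pi * \sum_(mu < n) (k 0 mu)%:~R * s 0 mu) in
  (cos t +i* sin t) *: form_pull (rotation s) (a k).

(* Omega^p(S^2n_theta) *)
Definition Omega (p : nat) (a : nc_form) : Prop :=
  [/\ tensor_hat a, forall s, torus_act s a = a & forall k, of_degree p (a k)].

Definition u0 (mu : 'I_n) : form R N := form_fun (fun x =>
  val x 0 (lshift 1 (lshift n mu)) +i* val x 0 (lshift 1 (rshift n mu))).

Definition v0 : form R N :=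
  form_fun (fun x => (val x 0 (rshift (n + n) 0))%:C).

Definition one0 : form R N := form_fun (fun=> 1).

Definition u_nc (mu : 'I_n) : nc_form := pure (u0 mu) (delta_mx 0 mu).

Definition v_nc : nc_form := pure v0 0.

Definition one_nc : nc_form := pure one0 0.

End NCTorus.

(** * Clifford algebra, projections and self-duality *)

Section Clifford.
Variables (R : realType) (n : nat).
Notation mat := 'M[R[i]]_(2 ^ n).

Definition adjmx (A : mat) : mat := (map_mx Num.conj A)^T.

(* An irreducible *-representation of the deformed Clifford algebra on C^(2^n),
   given by the images of its generators; the subspaces of C^(2^n) are the row
   spaces of the matrices W, so matrices act on them through their transposes. *)
Definition cliff_irrep (theta : 'M[R]_n) (G : 'I_n -> mat) : Prop :=
  [/\ forall mu nu, G mu *m G nu + lam theta nu mu *: (G nu *m G mu) = 0,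
      forall mu nu, adjmx (G mu) *m adjmx (G nu)
        + lam theta nu mu *: (adjmx (G nu) *m adjmx (G mu)) = 0,
      forall mu nu, adjmx (G mu) *m G nu
        + lam theta mu nu *: (G nu *m adjmx (G mu)) = (mu == nu)%:R%:M
    & forall W : mat, W != 0 ->
        (forall mu, stablemx W (G mu)^T && stablemx W (adjmx (G mu))^T) ->
        row_full W].

Definition chirality (G : 'I_n -> mat) : mat :=
  \prod_(mu < n) (adjmx (G mu) *m G mu - G mu *m adjmx (G mu)).

Definition projection (V : lmodType R[i]) (one : V) (u ustar : 'I_n -> V)
    (v : V) (G : 'I_n -> mat) : 'M[V]_(2 ^ n) :=
  \matrix_(i, j) (2^-1 *:
    ((i == j)%:R *: one
     + \sum_(mu < n) (adjmx (G mu) i j *: u mu + G mu i j *: ustar mu)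
     + chirality G i j *: v)).

Definition mx_mul (V : lmodType R[i]) (mul : V -> V -> V) m (A B : 'M[V]_m) :
    'M[V]_m :=
  \matrix_(i, j) \sum_(k < m) mul (A i k) (B k j).

(* e (de)^n, for a product [mul] and a differential [d] on V *)
Definition e_de_n (V : lmodType R[i]) (mul : V -> V -> V) (d : V -> V)
    (e : 'M[V]_(2 ^ n)) : 'M[V]_(2 ^ n) :=
  iter n (fun A => mx_mul mul A (map_mx d e)) e.

Definition self_dual (V : lmodType R[i]) (mul : V -> V -> V) (d hodge : V -> V)
    (e : 'M[V]_(2 ^ n)) : Prop :=
  map_mx hodge (e_de_n mul d e)
  = map_mx (fun w => ('i : R[i]) ^+ n *: w) (e_de_n mul d e).

Definition classical_projection (G : 'I_n -> mat) :=
  projection (@one0 R n) (@u0 R n) (fun mu => form_conj (u0 mu)) (@v0 R n) G.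

(* This holds for exactly one orientation o, and serves to fix it. *)
Definition classical_self_dual (o : bool) (G : 'I_n -> mat) : Prop :=
  self_dual (@form_mul R _) (@form_d R _) (form_hodge o)
    (classical_projection G).

Definition nc_projection (theta : 'M[R]_n) (G : 'I_n -> mat) :=
  projection (@one_nc R n) (@u_nc R n)
    (fun mu => nc_star theta (u_nc mu)) (@v_nc R n) G.

Definition nc_self_dual (theta : 'M[R]_n) (o : bool) (G : 'I_n -> mat) : Prop :=
  self_dual (nc_mul theta) (@nc_d R n) (nc_hodge o) (nc_projection theta G).

End Clifford.

(* Main.v *)
(* The elements Gamma^mu (x) (U^mu)^* of M_(2^n)(C) (x) C(T_theta) satisfy the
   Clifford relations for theta = 0, since the phases of the U's cancel those of
   the Gamma's. They thus define a homomorphism Phi from the classical Clifford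
   algebra M_(2^n)(C) to M_(2^n)(C) (x) C(T_theta), and Psi = Phi (x) id maps the
   classical projection P to e. It intertwines products and differentials, so it
   maps P (dP)^n to e (de)^n; being C-linear in the matrix part it commutes with
   the Hodge operator, and self-duality is transported from P to e.
   Phi X is given by 2^-n * sum_S tr(X g_S^-1) v_S, where g_S runs over the
   products of the 2n hermitian generators of Cliff(R^2n) and v_S over the
   corresponding deformed products. That Phi is multiplicative and unital only
   uses that tr g_S = 0 for nonempty S, which holds as 2n is even. *)

From HB Require Import structures.
From mathcomp Require Import all_boot all_order all_algebra.
From mathcomp Require Import all_classical all_reals all_analysis.
From mathcomp Require Import summability.
From mathcomp Require Import complex.
From mathcomp Require Import ring finmap.
Require Import Defs.

Set Implicit Arguments.
Unset Strict Implicit.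
Unset Printing Implicit Defensive.

Import Order.TTheory GRing.Theory Num.Theory numFieldNormedType.Exports.

Local Open Scope ring_scope.
Local Open Scope complex_scope.
(** * Clifford algebras as matrix algebras *)

Section CliffordWords.
Variables (C : comPzRingType) (I : finType).

Definition toggle (i : I) (S : {set I}) : {set I} :=
  [set j | (j \in S) (+) (j == i)].

Lemma toggleK i : involutive (toggle i).
Proof. by move=> S; apply/setP => j; rewrite !inE -addbA addbb addbF. Qed.

(** An ordered monomial in the generators, applied to [v]. A general [act] covers both the matrix
    products g_S and their images under the homomorphism to be built. *)
Fixpoint word (V : Type) (act : I -> V -> V) (v : V) (S : {set I})
    (s : seq I) : V :=
  if s is j :: s' then
    if j \in S then act j (word act v S s') else word act v S s'
  else v.

(** Counts the factors preceding [i], hence the signs picked up when [i] is moved to its place;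
    whether [i] itself lies in [S] does not matter. *)
Fixpoint flips (i : I) (S : {set I}) (s : seq I) : nat :=
  if s is j :: s' then if i == j then 0%N else ((j \in S) + flips i S s')%N
  else 0%N.

Lemma flips_toggle i S s : flips i (toggle i S) s = flips i S s.
Proof.
elim: s => //= j s ->; case: eqP => // /eqP nij.
by rewrite inE eq_sym (negbTE nij) addbF.
Qed.

Lemma word_toggle_notin V (act : I -> V -> V) v i S s : i \notin s ->
  word act v (toggle i S) s = word act v S s.
Proof.
elim: s => //= j s IH; rewrite inE negb_or => /andP[nij /IH ->].
by rewrite inE eq_sym (negbTE nij) addbF.
Qed.

Lemma word_set0 V (act : I -> V -> V) v s : word act v finset.set0 s = v.
Proof. by elim: s => //= j s ->; rewrite inE. Qed.

(** [act i] anticommutes past the factors before its position; there it cancels against an equal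
    factor or is inserted, and [toggle] covers both cases. *)
Lemma act_word (V : lmodType C) (act : I -> V -> V) (v : V) i S s :
    (forall j a w, act j (a *: w) = a *: act j w) ->
    (forall j w, act j (act j w) = w) ->
    (forall j k w, j != k -> act j (act k w) = - act k (act j w)) ->
    uniq s -> i \in s ->
  act i (word act v S s) = (-1) ^+ flips i S s *: word act v (toggle i S) s.
Proof.
move=> actZ actK actC; elim: s => //= j s IH /andP[js us]; rewrite inE.
have [eij _|nij /= /(IH us) E] := eqVneq i j.
  rewrite -{}eij in js *.
  rewrite expr0 scale1r inE eqxx addbT word_toggle_notin //.
  by case: (i \in S) => /=; rewrite ?actK.
rewrite inE eq_sym (negbTE nij) addbF.
case: (j \in S) => /=; last by rewrite E.
by rewrite actC // E actZ exprS mulN1r scaleNr.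
Qed.

End CliffordWords.

Section CliffordMatrices.
Variables (C : numFieldType) (I : finType) (d : nat) (g : I -> 'M[C]_d).
Hypothesis gg : forall i, g i *m g i = 1%:M.
Hypothesis gC : forall i j, i != j -> g i *m g j = - (g j *m g i).

Definition clifford_word (S : {set I}) : 'M[C]_d :=
  word (fun i (A : 'M[C]_d) => g i *m A) 1%:M S (enum I).

Lemma mul_clifford_word i S :
  g i *m clifford_word S =
    (-1) ^+ flips i S (enum I) *: clifford_word (toggle i S).
Proof.
apply: act_word => [j a A|j A|j k A jk||]; rewrite ?enum_uniq ?mem_enum //.
- by rewrite scalemxAr.
- by rewrite mulmxA gg mul1mx.
- by rewrite !mulmxA gC // mulNmx.
Qed.

Lemma clifford_word_comm i S :
  g i *m clifford_word S = (-1) ^+ #|S :\ i| *: (clifford_word S *m g i).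
Proof.
rewrite cardE /enum_mem size_filter -enumT /clifford_word.
elim: (enum I) => /= [|j s IH]; first by rewrite scale1r mul1mx mulmx1.
rewrite !inE; have [->|nij] := eqVneq j i => /=.
  by case: ifP => // _; rewrite -mulmxA scalemxAr -IH.
case: (j \in S) => //=; rewrite mulmxA gC 1?eq_sym // mulNmx -[in LHS]mulmxA IH.
by rewrite add1n exprS mulN1r scaleNr -scalemxAr mulmxA.
Qed.

(** If g_i anticommutes with the word, conjugation by g_i reverses the sign of its trace, which must
    vanish. Such an i is taken outside [S] if [#|S|] is odd, which is possible as [#|I|] is even,
    and inside [S] if [#|S|] is even. *)
Lemma mxtrace_clifford_word S : ~~ odd #|I| -> S != finset.set0 ->
  \tr (clifford_word S) = 0.
Proof.
move=> evenI S0.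
suff [i oddi] : exists i, odd #|S :\ i|.
  have E : g i *m clifford_word S *m g i = - clifford_word S.
    by rewrite clifford_word_comm -signr_odd oddi scaleN1r mulNmx -mulmxA gg
      mulmx1.
  have trN : \tr (clifford_word S) = - \tr (clifford_word S).
    by rewrite -[in RHS]linearN -E /= mxtrace_mulC mulmxA gg mul1mx.
  have : \tr (clifford_word S) *+ 2 = 0 by rewrite mulr2n {1}trN addNr.
  by move/eqP; rewrite mulrn_eq0 /= => /eqP.
have [oddS|evenS] := boolP (odd #|S|).
  have /set0Pn[i iS] : ~: S != finset.set0.
    by apply: contraNneq evenI => CS0; rewrite -(cardsC S) CS0 cards0 addn0.
  exists i; rewrite (cardsD1 i S) in oddS.
  by move: iS oddS; rewrite inE => /negbTE ->.
have /set0Pn[i iS] := S0; exists i.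
by move: evenS; rewrite (cardsD1 i S) iS /= negbK.
Qed.

Lemma tr_clifford_word S : ~~ odd #|I| ->
  \tr (clifford_word S) = (S == finset.set0)%:R * d%:R.
Proof.
move=> evenI; have [->|/mxtrace_clifford_word ->] := eqVneq; rewrite ?mul0r //.
by rewrite /clifford_word word_set0 mxtrace1 mul1r.
Qed.

Section Intertwiner.
Variables (V : lmodType C) (act : I -> {linear V -> V}) (v1 : V).
Hypothesis actK : forall i v, act i (act i v) = v.
Hypothesis actC : forall i j v, i != j -> act i (act j v) = - act j (act i v).

(* [g i |-> act i] extends to the algebra generated by the [g i]; this is the
   extension followed by evaluation at [v1]. *)
Definition clifford_map (A : 'M[C]_d) : V :=
  d%:R^-1 *: \sum_(S : {set I})
    \tr (A *m clifford_word S) *: word (fun i => act i) v1 S (enum I).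

Lemma clifford_map_linear : linear clifford_map.
Proof.
move=> a A B; rewrite /clifford_map scalerA mulrC -scalerA -scalerDr.
congr (_ *: _); rewrite scaler_sumr -big_split /=; apply: eq_bigr => S _.
by rewrite mulmxDl -scalemxAl linearP /= scalerDl scalerA.
Qed.

(** Up to the factor d, the trace against g_S reads off the coefficient of g_S^-1, whose factors are
    those of g_S reversed; [word] applies the matching right multiplications in that order. *)
Lemma clifford_map_mul A i : clifford_map (A *m g i) = act i (clifford_map A).
Proof.
rewrite /clifford_map linearZ; congr (_ *: _).
(* The summand of [toggle i S] on the left is matched with that of [S] on the right; the two signs
   agree by [flips_toggle]. *)
rewrite linear_sum (reindex_inj (inv_inj (toggleK i))) /=.
apply: eq_bigr => S _; rewrite linearZ /= -mulmxA mul_clifford_word toggleK.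
rewrite -scalemxAr linearZ /= (@act_word C I V (fun i => act i)) //.
- by rewrite flips_toggle scalerA mulrC -scalerA [_ *: (_ *: _)]scalerA mulrC.
- by move=> j a w; rewrite linearZ.
- exact: enum_uniq.
- exact: mem_enum.
Qed.

Lemma clifford_map1 : ~~ odd #|I| -> (0 < d)%N -> clifford_map 1%:M = v1.
Proof.
move=> evenI d0; rewrite /clifford_map (bigD1 finset.set0) //= big1 => [|S S0].
  rewrite addr0 mul1mx tr_clifford_word // eqxx mul1r word_set0 scalerA.
  by rewrite mulVf ?scale1r // pnatr_eq0 -lt0n.
by rewrite mul1mx mxtrace_clifford_word ?scale0r.
Qed.

Lemma clifford_map_exists : ~~ odd #|I| -> (0 < d)%N ->
  exists Phi : 'M[C]_d -> V, [/\ linear Phi, Phi 1%:M = v1 &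
    forall A i, Phi (A *m g i) = act i (Phi A)].
Proof.
move=> evenI d0; exists clifford_map; split; first exact: clifford_map_linear.
  exact: clifford_map1.
exact: clifford_map_mul.
Qed.

End Intertwiner.
End CliffordMatrices.
(** * Calculus away from the origin *)

Section Calculus.
Variables (R : realType) (V W : normedModType R).

(** The first-order expansion of [f], with its differential, is also one of [g], since the functions
    agree near [x]. *)
Lemma near_eq_differentiable (f g : V -> W) (x : V) :
  (\near x, f x = g x) -> differentiable f x -> differentiable g x.
Proof.
move=> fg /diff_locallyP[cf /eqaddoP of_].
suff og : g \o shift x = cst (g x) + 'd f x +o_ 0 id.
  by apply/diff_locallyP; rewrite (diff_unique cf og).
apply/eqaddoP => e e0.
have fg0 : \forall h \near (0 : V), f (h + x) = g (h + x).
  move: fg; rewrite (near_shift 0 x) /=.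
  by apply: filterS => h /=; rewrite subr0.
have := of_ _ e0; apply: filter_app; near=> h => /=.
rewrite !fctE /= -(nbhs_singleton fg) -(near fg0 h) //.
Unshelve. all: by end_near. Qed.

Lemma derive_scalar_comp (g : V -> R) (f : R -> R) (x v : V) :
  differentiable g x -> derivable f (g x) 1 ->
  'D_v (f \o g) x = 'D_v g x * 'D_1 f (g x).
Proof.
move=> dg /derivable1_diffP df.
rewrite !deriveE //; last exact: differentiable_comp.
by rewrite diff_comp //= -['d g x v in LHS]mulr1 linearZ.
Qed.

End Calculus.

(** * The Euclidean norm and its derivatives *)

Section EuclideanNorm.
Variables (R : realType) (N : nat).
Implicit Types y : 'rV[R]_N.

Lemma derive_coord y v (j : 'I_N) : 'D_v (fun z : 'rV[R]_N => z 0 j) y = v 0 j.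
Proof.
apply: lim_near_cst => //; near=> h => /=.
rewrite !mxE addrK /= -[_ *: _]/(_ * _) mulrA mulVf ?mul1r //.
by near: h; exact: nbhs_dnbhs_neq.
Unshelve. all: by end_near. Qed.

Lemma differentiable_sqnorm y : differentiable (@sqnorm R N) y.
Proof.
have -> : @sqnorm R N = \sum_(i < N) (fun z : 'rV[R]_N => z 0 i) ^+ 2.
  by apply/funext => z; rewrite fct_sumE.
by apply: differentiable_sum => i; apply/differentiableX/differentiable_coord.
Qed.

Lemma derive_sqnorm y i : 'D_(delta_mx 0 i) (@sqnorm R N) y = 2 * y 0 i.
Proof.
have -> : @sqnorm R N = \sum_(i < N) (fun z : 'rV[R]_N => z 0 i) ^+ 2.
  by apply/funext => z; rewrite fct_sumE.
have dc j : derivable (fun z : 'rV[R]_N => z 0 j) y (delta_mx 0 i).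
  exact/diff_derivable/differentiable_coord.
rewrite derive_sum => [|j]; last exact: derivableX.
rewrite (bigD1 i) //= big1 => [|j ji]; rewrite deriveX // derive_coord mxE eqxx.
  by rewrite addr0 eqxx /= expr1 -[_ *: _]/(_ * _) mulr1.
by rewrite (negbTE ji) scaler0.
Qed.

Lemma sqnorm_gt0 y : y != 0 -> 0 < sqnorm y.
Proof.
move=> /rV0Pn[i yi]; rewrite /sqnorm (bigD1 i) //= ltr_pwDl ?exprn_even_gt0 //.
by apply: sumr_ge0 => j _; rewrite sqr_ge0.
Qed.

Lemma sqnormZ a y : sqnorm (a *: y) = a ^+ 2 * sqnorm y.
Proof. by rewrite mulr_sumr; apply: eq_bigr => i _; rewrite mxE exprMn. Qed.

Definition invnorm y : R := (Num.sqrt (sqnorm y))^-1.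

Lemma sqnorm_normalize y : y != 0 -> sqnorm (invnorm y *: y) == 1.
Proof.
move=> y0; have s0 := sqnorm_gt0 y0.
by rewrite sqnormZ exprVn sqr_sqrtr ?(ltW s0) // mulVf ?eqxx ?gt_eqF.
Qed.

Let differentiable_norm y : y != 0 ->
  differentiable (fun z => Num.sqrt (@sqnorm R N z)) y.
Proof.
move=> y0; apply: differentiable_comp; first exact: differentiable_sqnorm.
apply/derivable1_diffP; have := is_derive1_sqrt (sqnorm_gt0 y0).
by move=> /(@ex_derive _ _ _ _ _ _ _).
Qed.

Lemma differentiable_invnorm y : y != 0 -> differentiable invnorm y.
Proof.
move=> y0; apply: differentiableV; first exact: differentiable_norm.
by rewrite gt_eqF // sqrtr_gt0 sqnorm_gt0.
Qed.

Lemma derive_invnorm y i : y != 0 ->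
  'D_(delta_mx 0 i) invnorm y = - (y 0 i * invnorm y ^+ 3).
Proof.
move=> y0; have s0 := sqnorm_gt0 y0.
rewrite deriveV; last 2 first.
- by rewrite gt_eqF // sqrtr_gt0.
- exact/diff_derivable/differentiable_norm.
rewrite (@derive_scalar_comp _ _ (@sqnorm R N) Num.sqrt); last 2 first.
- exact: differentiable_sqnorm.
- by have := is_derive1_sqrt s0; move=> /(@ex_derive _ _ _ _ _ _ _).
rewrite derive_sqnorm derive_sqrt // /invnorm -[_ *: _]/(_ * _).
have : Num.sqrt (sqnorm y) != 0 by rewrite gt_eqF // sqrtr_gt0.
by move: (Num.sqrt _) => t t0; field.
Qed.

Lemma near_neq0 y : y != 0 -> \near y, y != 0.
Proof.
move=> y0; apply: open_nbhs_nbhs; split => //.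
rewrite (_ : (fun z => _) = ~` [set 0]%classic)%classic; last first.
  by apply/seteqP; split => z /= /eqP.
apply: closed_openC; apply: accessible_closed_set1; apply: hausdorff_accessible.
exact: norm_hausdorff.
Qed.

End EuclideanNorm.

(** * A class of functions closed under partial derivatives *)

Section RegularFunctions.
Variables (R : realType) (N : nat).
Implicit Types (y : 'rV[R]_N) (i : 'I_N).

(* Functions on R^N minus the origin generated by the coordinates and 1/|y|.
   The syntax makes them closed under iterated partial derivatives, and bounded
   on the unit sphere, by recursion. *)
Inductive regular_expr :=
| RegOne
| RegAdd of regular_expr & regular_expr
| RegScale of R[i] & regular_expr
| RegCoord of 'I_N & regular_expr
| RegInvnorm of regular_expr.

Fixpoint reg_eval (t : regular_expr) (y : 'rV[R]_N) : R[i] :=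
  match t with
  | RegOne => 1
  | RegAdd t1 t2 => reg_eval t1 y + reg_eval t2 y
  | RegScale c t1 => c * reg_eval t1 y
  | RegCoord j t1 => (y 0 j)%:C * reg_eval t1 y
  | RegInvnorm t1 => (invnorm y)%:C * reg_eval t1 y
  end.

(** The Leibniz rule; the last case rests on the derivative - y_i |y|^-3 of 1/|y|, which stays in
    the class. *)
Fixpoint reg_partial (i : 'I_N) (t : regular_expr) : regular_expr :=
  match t with
  | RegOne => RegScale 0 RegOne
  | RegAdd t1 t2 => RegAdd (reg_partial i t1) (reg_partial i t2)
  | RegScale c t1 => RegScale c (reg_partial i t1)
  | RegCoord j t1 =>
      RegAdd (RegScale (i == j)%:R t1) (RegCoord j (reg_partial i t1))
  | RegInvnorm t1 =>
      RegAdd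
        (RegScale (-1)
           (RegCoord i (RegInvnorm (RegInvnorm (RegInvnorm t1)))))
        (RegInvnorm (reg_partial i t1))
  end.

Lemma cdifferentiable_cst (c : R[i]) y : cdifferentiable (fun=> c) y.
Proof. by split; apply: differentiable_cst. Qed.

Lemma partial_cst (c : R[i]) i y : partial i (fun=> c) y = 0.
Proof. by rewrite /partial !derive_cst. Qed.

Lemma cdifferentiableD (f g : 'rV[R]_N -> R[i]) y :
  cdifferentiable f y -> cdifferentiable g y ->
  cdifferentiable (fun z => f z + g z) y.
Proof.
move=> [fr fi] [gr gi]; split.
  rewrite (_ : (fun z => _) =
      (fun z => complex.Re (f z)) + (fun z => complex.Re (g z))).
    exact: differentiableD.
  by apply/funext => z; rewrite fctE raddfD.
rewrite (_ : (fun z => _) =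
    (fun z => complex.Im (f z)) + (fun z => complex.Im (g z))).
  exact: differentiableD.
by apply/funext => z; rewrite fctE raddfD.
Qed.

Lemma partialD (f g : 'rV[R]_N -> R[i]) i y :
  cdifferentiable f y -> cdifferentiable g y ->
  partial i (fun z => f z + g z) y = partial i f y + partial i g y.
Proof.
move=> [/diff_derivable fr /diff_derivable fi].
move=> [/diff_derivable gr /diff_derivable gi]; rewrite /partial.
rewrite (_ : (fun z => complex.Re (_ + _)) =
  (fun z => complex.Re (f z)) + (fun z => complex.Re (g z))); last first.
  by apply/funext => z; rewrite fctE raddfD.
rewrite (_ : (fun z => complex.Im (_ + _)) =
  (fun z => complex.Im (f z)) + (fun z => complex.Im (g z))); last first.
  by apply/funext => z; rewrite fctE raddfD.
by rewrite !deriveD.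
Qed.

Lemma cdifferentiableMr (r : 'rV[R]_N -> R) (f : 'rV[R]_N -> R[i]) y :
  differentiable r y -> cdifferentiable f y ->
  cdifferentiable (fun z => (r z)%:C * f z) y.
Proof.
move=> dr [fr fi]; split.
  rewrite (_ : (fun z => _) = r * (fun z => complex.Re (f z))).
    exact: differentiableM.
  by apply/funext => z; rewrite fctE; case: (f z) => a b /=; rewrite mul0r subr0.
rewrite (_ : (fun z => _) = r * (fun z => complex.Im (f z))).
  exact: differentiableM.
by apply/funext => z; rewrite fctE; case: (f z) => a b /=; rewrite mul0r addr0.
Qed.

Lemma partialMr (r : 'rV[R]_N -> R) (f : 'rV[R]_N -> R[i]) i y :
  differentiable r y -> cdifferentiable f y ->
  partial i (fun z => (r z)%:C * f z) y =
    ('D_(delta_mx 0 i) r y)%:C * f y + (r y)%:C * partial i f y.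
Proof.
move=> /diff_derivable dr [/diff_derivable fr /diff_derivable fi].
rewrite /partial.
rewrite (_ : (fun z => complex.Re _) = r * (fun z => complex.Re (f z))); last first.
  by apply/funext => z; rewrite fctE; case: (f z) => a b /=; rewrite mul0r subr0.
rewrite (_ : (fun z => complex.Im _) = r * (fun z => complex.Im (f z))); last first.
  by apply/funext => z; rewrite fctE; case: (f z) => a b /=; rewrite mul0r addr0.
rewrite !deriveM //= ; case: (f y) => a b; apply/eqP; rewrite eq_complex /=.
by rewrite /GRing.scale /=; apply/andP; split; apply/eqP; ring.
Qed.

Lemma cdifferentiableZ (c : R[i]) (f : 'rV[R]_N -> R[i]) y :
  cdifferentiable f y -> cdifferentiable (fun z => c * f z) y.
Proof.
case: c => a b [fr fi]; split.
  rewrite (_ : (fun z => _) = a *: (fun z => complex.Re (f z))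
     - b *: (fun z => complex.Im (f z))).
    by apply: differentiableB; exact: differentiableZ.
  by apply/funext => z; rewrite !fctE /=; case: (f z) => p q /=.
rewrite (_ : (fun z => _) = a *: (fun z => complex.Im (f z))
     + b *: (fun z => complex.Re (f z))).
  by apply: differentiableD; exact: differentiableZ.
by apply/funext => z; rewrite !fctE /=; case: (f z) => p q /=.
Qed.

Lemma partialZ (c : R[i]) (f : 'rV[R]_N -> R[i]) i y :
  cdifferentiable f y ->
  partial i (fun z => c * f z) y = c * partial i f y.
Proof.
case: c => a b [/diff_derivable fr /diff_derivable fi]; rewrite /partial.
rewrite (_ : (fun z => complex.Re (_ * f z)) = a *: (fun z => complex.Re (f z))
     - b *: (fun z => complex.Im (f z))); last first.
  by apply/funext => z; rewrite !fctE /=; case: (f z) => p q /=.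
rewrite (_ : (fun z => complex.Im (_ * f z)) = a *: (fun z => complex.Im (f z))
     + b *: (fun z => complex.Re (f z))); last first.
  by apply/funext => z; rewrite !fctE /=; case: (f z) => p q /=.
by rewrite deriveB ?deriveD ?deriveZ //; try exact: derivableZ.
Qed.

Lemma cdifferentiable_reg_eval t y : y != 0 -> cdifferentiable (reg_eval t) y.
Proof.
move=> y0; elim: t => [|t1 IH1 t2 IH2|c t IH|j t IH|t IH] /=.
- exact: cdifferentiable_cst.
- exact: cdifferentiableD.
- exact: cdifferentiableZ.
- by apply: cdifferentiableMr => //; exact: differentiable_coord.
- by apply: cdifferentiableMr => //; exact: differentiable_invnorm.
Qed.

Lemma partial_reg_eval t i y : y != 0 ->
  partial i (reg_eval t) y = reg_eval (reg_partial i t) y.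
Proof.
move=> y0; have cd := cdifferentiable_reg_eval _ y0.
elim: t => [|t1 IH1 t2 IH2|c t IH|j t IH|t IH] /=.
- by rewrite partial_cst mul0r.
- by rewrite partialD ?IH1 ?IH2.
- by rewrite partialZ ?IH.
- rewrite partialMr ?IH //; last exact: differentiable_coord.
  by rewrite derive_coord mxE eqxx (eq_sym j) /= rmorph_nat.
- rewrite partialMr ?IH //; last exact: differentiable_invnorm.
  by rewrite derive_invnorm //; ring.
Qed.

Lemma near_eq_partial (f g : 'rV[R]_N -> R[i]) i y :
  (\near y, f y = g y) -> partial i f y = partial i g y.
Proof.
move=> fg; rewrite /partial; congr (_ +i* _); apply: near_eq_derive.
  by apply: filterS fg => z ->.
by apply: filterS fg => z ->.
Qed.

Lemma near_eq_cdifferentiable (f g : 'rV[R]_N -> R[i]) y :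
  (\near y, f y = g y) -> cdifferentiable f y -> cdifferentiable g y.
Proof.
move=> fg [fr fi]; split.
  by apply: near_eq_differentiable fr; apply: filterS fg => z ->.
by apply: near_eq_differentiable fi; apply: filterS fg => z ->.
Qed.

(** Each further derivative requires equality on a neighbourhood of [y]; the induction provides it
    because the complement of the origin is open. *)
Lemma partials_reg_eval (f : 'rV[R]_N -> R[i]) t s y :
    (forall z, z != 0 -> f z = reg_eval t z) -> y != 0 ->
  partials s f y = reg_eval (foldr reg_partial t s) y.
Proof.
move=> ft; elim: s y => [|i s IH] y y0 /=; first exact: ft.
rewrite -partial_reg_eval //; apply: near_eq_partial.
by apply: filterS (near_neq0 y0) => z /IH.
Qed.

Lemma cdifferentiable_partials (f : 'rV[R]_N -> R[i]) t s y :
    (forall z, z != 0 -> f z = reg_eval t z) -> y != 0 ->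
  cdifferentiable (partials s f) y.
Proof.
move=> ft y0.
apply: near_eq_cdifferentiable
  (cdifferentiable_reg_eval (foldr reg_partial t s) y0).
by apply: filterS (near_neq0 y0) => z z0; rewrite (partials_reg_eval s ft).
Qed.

Lemma sphere_neq0 (x : sphere R N) : val x != 0.
Proof.
apply: contraTneq (valP x) => ->.
by rewrite -[0](scale0r 0) sqnormZ expr0n mul0r eq_sym oner_eq0.
Qed.

Lemma invnorm_sphere (x : sphere R N) : invnorm (val x) = 1.
Proof. by rewrite /invnorm (eqP (valP x)) sqrtr1 invr1. Qed.

(** On the unit sphere coordinates have modulus at most 1 and the inverse norm is 1, so every
    constructor preserves boundedness. *)
Lemma reg_eval_bounded t : exists2 B : R[i], 0 <= B &
  forall x : sphere R N, `|reg_eval t (val x)| <= B.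
Proof.
elim: t => [|t1 [B1 B10 H1] t2 [B2 B20 H2]|c t [B B0 H]|j t [B B0 H]|t [B B0 H]] /=.
- by exists 1 => // x; rewrite normr1.
- exists (B1 + B2) => [|x]; first exact: addr_ge0.
  exact: le_trans (ler_normD _ _) (lerD (H1 x) (H2 x)).
- exists (`|c| * B) => [|x]; first by rewrite mulr_ge0.
  by rewrite normrM ler_wpM2l ?H.
- exists B => // x; rewrite normrM -[B]mul1r ler_pM ?H //.
  rewrite normc_def /= expr0n addr0 sqrtr_sqr -[leRHS](rmorph1 (real_complex R)) lecR.
  rewrite -(@expr_le1 _ 2) // real_normK ?num_real //.
  apply: le_trans (_ : sqnorm (val x) <= 1); last by rewrite (eqP (valP x)).
  rewrite /sqnorm (bigD1 j) //= lerDl.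
  by apply: sumr_ge0 => k _; rewrite sqr_ge0.
- by exists B => // x; rewrite invnorm_sphere mul1r H.
Qed.

End RegularFunctions.
(** * Forms on the sphere *)

Section RegularForms.
Variables (R : realType) (N : nat).
Implicit Types (w : form R N) (y : 'rV[R]_N).

(** Derivatives of arbitrary functions need not be additive, so linearity of [form_d] is proved on a
    class of forms with explicit radial extensions. The class also gives smoothness and bounds on
    all derivatives. *)
Definition regular_form w := forall S, exists t : regular_expr R N,
  forall y, y != 0 -> radial w y S = reg_eval t y.

Lemma radialP a w1 w2 y S :
  radial (a *: w1 + w2) y S = a * radial w1 y S + radial w2 y S.
Proof.
rewrite /radial; case: insubP => [x _ _|_]; last by rewrite mulr0 addr0.
by rewrite !fctE mulrDr mulrCA.
Qed.

Lemma radial0 y S : radial (0 : form R N) y S = 0.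
Proof. by rewrite /radial; case: insubP => // x _ _; rewrite mulr0. Qed.

Lemma regular_form0 : regular_form 0.
Proof.
by move=> S; exists (RegScale 0 (RegOne R N)) => y _; rewrite radial0 /= mul0r.
Qed.

Lemma regular_formP a w1 w2 :
  regular_form w1 -> regular_form w2 -> regular_form (a *: w1 + w2).
Proof.
move=> r1 r2 S; have [t1 e1] := r1 S; have [t2 e2] := r2 S.
by exists (RegAdd (RegScale a t1) t2) => y y0; rewrite radialP e1 ?e2.
Qed.

Lemma regular_formZ a w : regular_form w -> regular_form (a *: w).
Proof. by move=> rw; rewrite -[_ *: _]addr0; apply/regular_formP/regular_form0. Qed.

Lemma regular_form_sum (I : Type) (r : seq I) (F : I -> form R N) :
  (forall i, regular_form (F i)) -> regular_form (\sum_(i <- r) F i).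
Proof.
move=> rF; elim/big_rec: _ => [|i w _ rw]; first exact: regular_form0.
by rewrite -[F i]scale1r; exact: regular_formP.
Qed.

Lemma form_d0 : form_d (0 : form R N) = 0.
Proof.
apply/funext => x; apply/funext => S; rewrite /form_d big1 // => i _.
rewrite (_ : (fun y => _) = fun=> 0) ?partial_cst ?mulr0 //.
by apply/funext => y; rewrite radial0.
Qed.

Lemma form_dP a w1 w2 : regular_form w1 -> regular_form w2 ->
  form_d (a *: w1 + w2) = a *: form_d w1 + form_d w2.
Proof.
move=> r1 r2; apply/funext => x; apply/funext => S.
rewrite !fctE /form_d scaler_sumr -big_split /=; apply: eq_bigr => i _.
have x0 := sphere_neq0 x; have nx := near_neq0 x0.
have [t1 e1] := r1 (S :\ i); have [t2 e2] := r2 (S :\ i).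
rewrite [X in _ * X](@near_eq_partial _ _ _ (reg_eval (RegAdd (RegScale a t1) t2))).
  rewrite (@near_eq_partial _ _ (radial w1 ^~ (S :\ i)) (reg_eval t1)).
    rewrite (@near_eq_partial _ _ (radial w2 ^~ (S :\ i)) (reg_eval t2)).
      rewrite !partial_reg_eval //= mulrDr; congr (_ + _).
      by rewrite mulrCA.
    by apply: filterS nx => y; exact: e2.
  by apply: filterS nx => y; exact: e1.
by apply: filterS nx => y y0; rewrite radialP e1 ?e2.
Qed.

Lemma form_dZ a w : regular_form w -> form_d (a *: w) = a *: form_d w.
Proof.
move=> rw; rewrite -[a *: w]addr0 form_dP ?form_d0 ?addr0 //.
exact: regular_form0.
Qed.

Lemma form_d_sum (I : Type) (r : seq I) (F : I -> form R N) :
    (forall i, regular_form (F i)) ->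
  form_d (\sum_(i <- r) F i) = \sum_(i <- r) form_d (F i).
Proof.
move=> rF; elim: r => [|i r IH]; rewrite ?big_nil ?form_d0 // !big_cons.
rewrite -[F i]scale1r form_dP ?IH ?scale1r //; exact: regular_form_sum.
Qed.

Lemma regular_form_smooth w : of_degree 0 w -> regular_form w -> smooth_form w.
Proof.
move=> w0 rw; split=> [x|S s y y0].
  (* The contraction reads only coefficients at sets [i |: S]; these are nonempty, so a form of
     degree 0 vanishes there. *)
  apply/funext => S; rewrite /contract big1 // => i iS.
  by rewrite w0 ?mulr0 // cardsU1 iS.
have [t e] := rw S; exact: cdifferentiable_partials e y0.
Qed.

Lemma regular_form_bounded w S s : regular_form w ->
  exists2 B : R[i], 0 <= B & forall x : sphere R N,
    `|partials s (fun y => radial w y S) (val x)| <= B.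
Proof.
move=> /(_ S)[t e]; have [B B0 H] := reg_eval_bounded (foldr (@reg_partial _ _) t s).
by exists B => // x; rewrite (partials_reg_eval s e (sphere_neq0 x)).
Qed.

Lemma of_degree_form_fun f : of_degree 0 (@form_fun R N f).
Proof.
move=> x S; rewrite cards_eq0 /form_fun /ext_one => /negbTE ->.
by rewrite mulr0.
Qed.

Lemma radial_form_fun f y S : y != 0 -> exists2 x : sphere R N,
  val x = invnorm y *: y &
  radial (form_fun f) y S = f x * (S == finset.set0)%:R.
Proof.
move=> /sqnorm_normalize y1; rewrite /radial -/(invnorm y).
case: insubP => [x _ e|]; last by rewrite y1.
exists x => //; rewrite /form_fun /ext_one.
by have [->|_] := eqVneq; rewrite ?mulr0 // cards0 expr0 invr1 mul1r.
Qed.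

Lemma regular_form_fun f t :
    (forall y (x : sphere R N), y != 0 -> val x = invnorm y *: y ->
      f x = reg_eval t y) ->
  regular_form (form_fun f).
Proof.
move=> ft S; exists (RegScale (S == finset.set0)%:R t) => y y0.
by have [x ex ->] := radial_form_fun f S y0; rewrite (ft y) // mulrC.
Qed.

Lemma form_pullP M a w1 w2 : form_pull M (a *: w1 + w2) =
  a *: form_pull M w1 + form_pull M w2.
Proof.
apply/funext => x; apply/funext => S.
rewrite !fctE /form_pull scaler_sumr -big_split /=; apply: eq_bigr => T _.
by rewrite radialP mulrDl -mulrA.
Qed.

(** A function has a coefficient only at the empty set, where [lin_pull] is [ext_one]; as [val z]
    has norm 1, [radial] returns [f z] there. *)
Lemma form_pull_form_fun (M : 'M[R]_N) f (x z : sphere R N) :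
  val z = val x *m M -> form_pull M (form_fun f) x = form_fun f z.
Proof.
move=> ez; apply/funext => S; rewrite /form_pull (bigD1 finset.set0) //= big1.
  rewrite addr0 -ez; have [z' ez' ->] := radial_form_fun f finset.set0 (sphere_neq0 z).
  rewrite eqxx mulr1 /lin_pull enum_set0 /=; congr (f _ * _).
  by apply: val_inj; rewrite ez' invnorm_sphere scale1r.
move=> T T0; rewrite -ez; have [z' _ ->] := radial_form_fun f T (sphere_neq0 z).
by rewrite (negbTE T0) mulr0 mul0r.
Qed.

Lemma form_hodgeP o a w1 w2 : form_hodge o (a *: w1 + w2) =
  a *: form_hodge o w1 + form_hodge o w2 :> form R N.
Proof.
apply/funext => x; apply/funext => S.
rewrite !fctE /form_hodge scaler_sumr -big_split /=; apply: eq_bigr => T _.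
by rewrite !mulrDl -!mulrA.
Qed.

Lemma form_mulPl (w : form R N) a w1 w2 : form_mul (a *: w1 + w2) w =
  a *: form_mul w1 w + form_mul w2 w :> form R N.
Proof.
apply/funext => x; apply/funext => S.
rewrite !fctE /form_mul /wedge scaler_sumr -big_split /=; apply: eq_bigr => T _.
by rewrite mulrDr mulrDl mulrCA -!mulrA.
Qed.

Lemma form_mulPr (w : form R N) a w1 w2 : form_mul w (a *: w1 + w2) =
  a *: form_mul w w1 + form_mul w w2 :> form R N.
Proof.
apply/funext => x; apply/funext => S.
rewrite !fctE /form_mul /wedge scaler_sumr -big_split /=; apply: eq_bigr => T _.
by rewrite mulrDr mulrCA.
Qed.

HB.instance Definition _ M := GRing.isLinear.Build _ _ _ _ _ (form_pullP M).
HB.instance Definition _ o := GRing.isLinear.Build _ _ _ _ _ (form_hodgeP o).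
HB.instance Definition _ w := GRing.isLinear.Build _ _ _ _ _ (form_mulPr w).

End RegularForms.
(** * The noncommutative torus *)

Section Cocycle.
Variables (R : realType) (n : nat) (theta : 'M[R]_n).
Local Notation C := R[i].
Local Notation coc := (cocycle theta).
Local Notation dl mu := (delta_mx 0 mu : 'rV[int]_n).

Lemma lam_neq0 mu nu : lam theta mu nu != 0.
Proof.
rewrite /lam eq_complex negb_and /= -negb_and; apply/negP => /andP[/eqP c0 /eqP s0].
have := cos2Dsin2 (theta mu nu); rewrite c0 s0 !expr0n addr0 => /eqP.
by rewrite eq_sym oner_eq0.
Qed.

Lemma cocycleDl k k' l : coc (k + k') l = coc k l * coc k' l.
Proof.
rewrite /cocycle -big_split /=; apply: eq_bigr => mu _.
rewrite -big_split /=; apply: eq_bigr => nu _.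
by rewrite mxE mulrDl expfzDr ?lam_neq0.
Qed.

Lemma cocycleDr k l l' : coc k (l + l') = coc k l * coc k l'.
Proof.
rewrite /cocycle -big_split /=; apply: eq_bigr => mu _.
rewrite -big_split /=; apply: eq_bigr => nu _.
by rewrite mxE mulrDr expfzDr ?lam_neq0.
Qed.

Lemma cocycle0l l : coc 0 l = 1.
Proof.
rewrite /cocycle big1 // => mu _; rewrite big1 // => nu _.
by rewrite mxE mul0r.
Qed.

Lemma cocycle0r k : coc k 0 = 1.
Proof.
rewrite /cocycle big1 // => mu _; rewrite big1 // => nu _.
by rewrite mxE mulr0.
Qed.

(** Multiples of basis vectors treat the generators U^mu and their inverses together. At most one
    factor of the double product survives. *)
Lemma cocycle_delta s t mu nu : coc (s *: dl mu) (t *: dl nu) =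
  if (nu < mu)%N then lam theta mu nu ^ (s * t) else 1.
Proof.
rewrite /cocycle (bigD1 mu) //= [X in _ * X]big1 ?mulr1 => [|k kmu]; last first.
  by rewrite big1 // => l _; rewrite !mxE (negbTE kmu) andbF mulr0 mul0r.
case: ifPn => numu.
  rewrite (bigD1 nu) //= big1 ?mulr1 => [|k /andP[_ knu]].
    by rewrite !mxE !eqxx !mulr1.
  by rewrite !mxE (negbTE knu) andbF !mulr0.
rewrite big1 // => k kmu; rewrite !mxE.
have [kn|] := eqVneq k nu; first by rewrite -kn kmu in numu.
by rewrite andbF !mulr0.
Qed.

Hypothesis antisym : theta^T = - theta.

Lemma lamV mu nu : lam theta mu nu = (lam theta nu mu)^-1.
Proof.
have E : theta mu nu = - theta nu mu.
  by move/matrixP: antisym => /(_ nu mu); rewrite !mxE.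
apply: (mulfI (lam_neq0 nu mu)); rewrite divff ?lam_neq0 // /lam E cosN sinN.
apply/eqP; rewrite eq_complex /=; apply/andP; split; apply/eqP; last by ring.
by rewrite mulrN opprK -!expr2 cos2Dsin2.
Qed.

Lemma lam_diag mu : lam theta mu mu = 1.
Proof.
have : theta mu mu *+ 2 = 0.
  move/matrixP: antisym => /(_ mu mu); rewrite !mxE => E.
  by rewrite mulr2n {1}E addNr.
by move/eqP; rewrite mulrn_eq0 /= => /eqP; rewrite /lam => ->; rewrite cos0 sin0.
Qed.

(** The relation between (U^mu)^s (U^nu)^t and the product in the other order. For distinct indices
    one of the two cocycles is 1 and the other carries the phase; antisymmetry of [theta] reconciles
    the two orderings. *)
Lemma cocycleC_delta s t mu nu : coc (s *: dl mu) (t *: dl nu) =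
  coc (t *: dl nu) (s *: dl mu) * lam theta mu nu ^ (s * t).
Proof.
rewrite !cocycle_delta; have [numu|munu|/val_inj ->] := ltngtP nu mu.
- by rewrite mul1r.
- rewrite (lamV mu nu) exprz_inv -expfzDr ?lam_neq0 //.
  by rewrite mulrC subrr expr0z.
- by rewrite lam_diag exp1rz mulr1.
Qed.

End Cocycle.

(** * Products of series with finitely many modes *)

Section NCMul.
Variables (R : realType) (n : nat) (theta : 'M[R]_n).
Local Notation C := R[i].
Local Notation Z := 'rV[int]_n.
Local Notation coc := (cocycle theta).
Local Notation formN := (form R (n + n + 1)).

(** Partial sums over finite sets containing every [p l] already equal the limit. The indices [p l]
    may coincide, so the family is written as a sum of indicators. *)
Lemma sum_finite_support (I : choiceType) (L : finType) (p : L -> I) (c : L -> C) :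
  sum (fun k => \sum_l (k == p l)%:R * c l : C^o) = \sum_l c l.
Proof.
apply: lim_near_cst => //.
  exact: totally_filter.
exists [fset p l | l in L]%fset => // A /fsubsetP pA /=.
rewrite /partial_sum exchange_big /=; apply: eq_bigr => l _.
have pAl : p l \in A by apply: pA; apply/imfsetP; exists l.
rewrite (bigD1 [` pAl]%fset) //= eqxx mul1r big1 ?addr0 // => k nk.
by rewrite (_ : _ == _ = false) ?mul0r //; apply/negbTE.
Qed.

(** With finitely many modes on the right, the convolution over Z^n collapses to a finite sum for
    any left factor, so later products raise no question of convergence. *)
Lemma nc_mul_sum_pure (L : finType) (w : L -> formN) (k : L -> Z) (a : nc_form R n) m :
  nc_mul theta a (\sum_l pure (w l) (k l)) m =
    \sum_l coc (m - k l) (k l) *: form_mul (a (m - k l)) (w l).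
Proof.
apply/funext => x; apply/funext => S; rewrite !fct_sumE.
rewrite -[RHS](@sum_finite_support _ _ (fun l => m - k l)).
rewrite /nc_mul; apply: (congr1 (fun f : Z -> C^o => sum f)).
apply/funext => h.
rewrite [X in form_mul _ X](_ : _ = \sum_l (h == m - k l)%:R *: w l); last first.
  apply: eq_bigr => l _; rewrite /pure.
  have -> : (m - h == k l) = (h == m - k l) by rewrite subr_eq addrC -subr_eq eq_sym.
  by case: ifP => _; rewrite ?scale1r ?scale0r.
rewrite linear_sum !fct_sumE mulr_sumr; apply: eq_bigr => l _.
rewrite linearZ /= !fctE.
have [->|_] := eqVneq h (m - k l); last by rewrite scale0r mulr0 mul0r.
by rewrite subKr scale1r mul1r.
Qed.

Lemma pureZ a (w : formN) k : pure (a *: w) k = a *: pure w k.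
Proof.
apply/funext => m; rewrite -[RHS]/(a *: pure w k m) /pure.
by case: ifP => _; rewrite ?scaler0.
Qed.

Lemma nc_star_u (mu : 'I_n) : theta^T = - theta ->
  nc_star theta (@u_nc R n mu) = pure (form_conj (u0 mu)) (- delta_mx 0 mu).
Proof.
move=> antisym; apply/funext => m; rewrite /nc_star /u_nc /pure eqr_oppLR.
case: eqP => [->|_].
  (* The phase is the cocycle of [delta_mx 0 mu] and its opposite, which is 1 since no index
     precedes itself. *)
  have := cocycle_delta theta 1 (-1) mu mu.
  by rewrite ltnn scale1r scaleN1r opprK => ->; rewrite invr1 scale1r.
rewrite (_ : form_conj _ = 0) ?scaler0 //.
by apply/funext => x; apply/funext => S; exact: conjc0.
Qed.

End NCMul.

(** * Right multiplications over the noncommutative torus *)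

Section TwistedTranslation.
Variables (R : realType) (n d : nat) (theta : 'M[R]_n).
Local Notation C := R[i].
Local Notation Z := 'rV[int]_n.
Local Notation coc := (cocycle theta).

(* Right multiplication by M (x) U^k on M_d (x) C^(Z^n) *)
Definition twist_mulr (M : 'M[C]_d) (k : Z) (F : Z -> 'M[C]_d) : Z -> 'M[C]_d :=
  fun m => coc (m - k) k *: (F (m - k) *m M).

Lemma twist_mulr_is_linear M k : linear (twist_mulr M k).
Proof.
move=> a F F'; apply/funext => m; rewrite !fctE /twist_mulr.
by rewrite mulmxDl -scalemxAl scalerDr !scalerA mulrC.
Qed.

HB.instance Definition _ M k :=
  GRing.isLinear.Build C (Z -> 'M[C]_d) (Z -> 'M[C]_d) _ (twist_mulr M k)
    (twist_mulr_is_linear M k).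

(** Both sides evaluate [F] at l = m - (k + k'); bimultiplicativity of the cocycle, after m - k' is
    split as l + k, equates the phases. *)
Lemma twist_mulrA M k M' k' F : twist_mulr M' k' (twist_mulr M k F) =
  coc k k' *: twist_mulr (M *m M') (k + k') F.
Proof.
apply/funext => m; rewrite fctE /twist_mulr -scalemxAl !scalerA mulmxA.
have -> : m - k' - k = m - (k + k') by rewrite opprD addrA addrAC.
congr (_ *: _); rewrite -{1}[m - k'](subrK k).
have -> : m - k' - k = m - (k + k') by rewrite opprD addrA addrAC.
move: (m - (k + k')) => l; rewrite cocycleDl cocycleDr; ring.
Qed.

Lemma twist_mulrP a M M' k F :
  twist_mulr (a *: M + M') k F = a *: twist_mulr M k F + twist_mulr M' k F.
Proof.
apply/funext => m; rewrite !fctE /twist_mulr.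
by rewrite mulmxDr -scalemxAr scalerDr !scalerA mulrC.
Qed.

Lemma twist_mulr1 F : twist_mulr 1%:M 0 F = F.
Proof.
by apply/funext => m; rewrite /twist_mulr subr0 cocycle0r scale1r mulmx1.
Qed.

Lemma twist_mulr0 k F : twist_mulr 0 k F = 0.
Proof. by apply/funext => m; rewrite /twist_mulr mulmx0 scaler0. Qed.

(** The phase [q] of the matrix relation is absorbed by the cocycles, so an undeformed
    anticommutator remains. When it is nonzero, the total degree [k + l] must be 0 for it to be a
    multiple of the identity. *)
Lemma twist_mulr_anticomm A k B l q c F :
    A *m B + q *: (B *m A) = c%:M -> coc l k = coc k l * q ->
    (c != 0 -> k + l = 0) ->
  twist_mulr B l (twist_mulr A k F) + twist_mulr A k (twist_mulr B l F) =
    (coc k l * c) *: F.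
Proof.
move=> AB ql kl; rewrite !twist_mulrA (addrC l) ql -scalerA -scalerDr -scalerA.
congr (_ *: _); rewrite [LHS]addrC -twist_mulrP [_ + A *m B]addrC AB.
have [->|c0] := eqVneq c 0.
  by rewrite scale0r -scalemx1 scale0r twist_mulr0.
by rewrite kl // -[c%:M]addr0 -scalemx1 twist_mulrP twist_mulr0 twist_mulr1 addr0.
Qed.

End TwistedTranslation.
(** * Deformation of the Clifford algebra *)

Section HermitianGenerators.
Variables (R : rcfType) (n : nat) (V : lmodType R[i]).
Variables a b : 'I_n -> {linear V -> V}.

(* The hermitian generators a + b (index inl) and i (b - a) (index inr) of the
   pairs b = a^*; the second one is written i^-1 a + i b. *)
Definition gen_index (i : 'I_n + 'I_n) : 'I_n :=
  match i with inl mu | inr mu => mu end.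

Definition gen_phase (i : 'I_n + 'I_n) : R[i] := if i is inl _ then 1 else 'i%C.

Definition hermitian_gen (i : 'I_n + 'I_n) (v : V) : V :=
  (gen_phase i)^-1 *: a (gen_index i) v + gen_phase i *: b (gen_index i) v.

Lemma hermitian_gen_is_linear i : linear (hermitian_gen i).
Proof.
move=> c v w; rewrite /hermitian_gen !linearP /= addrACA !scalerA.
by rewrite [c * _^-1]mulrC.
Qed.

HB.instance Definition _ i :=
  GRing.isLinear.Build R[i] V V _ (hermitian_gen i) (hermitian_gen_is_linear i).

Lemma mulii : 'i%C * 'i%C = -1 :> R[i].
Proof. by rewrite -expr2 sqr_i. Qed.

Lemma neq0i : 'i%C != 0 :> R[i].
Proof. by rewrite eq_complex /= negb_and oner_eq0 orbT. Qed.

Lemma invi : 'i%C^-1 = - 'i%C :> R[i].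
Proof. by apply: (mulfI neq0i); rewrite divff ?neq0i // mulrN mulii opprK. Qed.

(** With [cre_hermitian], this inverts the passage to hermitian generators, so that rules proved for
    these can be carried back to [a] and [b]. *)
Lemma ann_hermitian mu v :
  a mu v = 2^-1 *: (hermitian_gen (inl mu) v + 'i%C *: hermitian_gen (inr mu) v).
Proof.
rewrite /hermitian_gen /= invr1 !scale1r ['i%C *: (_ + _)]scalerDr.
rewrite !scalerA mulii divff ?neq0i //.
rewrite scale1r scaleN1r addrACA subrr addr0 -mulr2n -[a mu v *+ 2]scaler_nat scalerA.
by rewrite mulVf ?scale1r // pnatr_eq0.
Qed.

Lemma cre_hermitian mu v :
  b mu v = 2^-1 *: (hermitian_gen (inl mu) v - 'i%C *: hermitian_gen (inr mu) v).
Proof.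
rewrite /hermitian_gen /= invr1 !scale1r ['i%C *: (_ + _)]scalerDr.
rewrite !scalerA mulii divff ?neq0i //.
rewrite scale1r scaleN1r opprD opprK addrACA subrr add0r -mulr2n -[b mu v *+ 2]scaler_nat.
by rewrite scalerA mulVf ?scale1r // pnatr_eq0.
Qed.

Hypothesis aa : forall mu nu v, a mu (a nu v) + a nu (a mu v) = 0.
Hypothesis bb : forall mu nu v, b mu (b nu v) + b nu (b mu v) = 0.
Hypothesis ab : forall mu nu v,
  a nu (b mu v) + b mu (a nu v) = (mu == nu)%:R *: v.

(** Terms with two [a] or two [b] cancel. The mixed ones leave a phase ratio plus its inverse, which
    is 2 for equal phases and 0 for different ones, as i^-1 = -i. *)
Lemma hermitian_gen_anticomm i j v :
  hermitian_gen i (hermitian_gen j v) + hermitian_gen j (hermitian_gen i v) =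
    (2 * (i == j)%:R) *: v.
Proof.
have E k l : hermitian_gen k (hermitian_gen l v) =
    ((gen_phase k)^-1 * (gen_phase l)^-1) *: a (gen_index k) (a (gen_index l) v)
    + ((gen_phase k)^-1 * gen_phase l) *: a (gen_index k) (b (gen_index l) v)
    + ((gen_phase k * (gen_phase l)^-1) *: b (gen_index k) (a (gen_index l) v)
    + (gen_phase k * gen_phase l) *: b (gen_index k) (b (gen_index l) v)).
  rewrite {1}/hermitian_gen !linearD !linearZ /= !scalerA.
  by congr (_ *: _ + _ *: _ + (_ *: _ + _ *: _)); rewrite mulrC.
have phaseC : ((gen_phase i)^-1 * gen_phase j + gen_phase i * (gen_phase j)^-1)
    * (gen_index i == gen_index j)%:R = 2 * (i == j)%:R :> R[i].
  case: i j => [mu|mu] [nu|nu] /=.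
  - by rewrite (inj_eq (@inl_inj _ _)) invr1 mulr1.
  - by rewrite invr1 !mul1r invi subrr mul0r mulr0.
  - by rewrite invr1 !mulr1 invi addNr mul0r mulr0.
  - by rewrite (inj_eq (@inr_inj _ _)) mulVf ?mulfV ?neq0i.
rewrite !E addrACA [X in X + _]addrACA [X in _ + X]addrACA.
rewrite [(gen_phase j)^-1 * (gen_phase i)^-1]mulrC [gen_phase j * gen_phase i]mulrC.
rewrite -!scalerDr aa bb !scaler0 addr0 add0r.
rewrite [X in _ + X]addrC addrACA [gen_phase j / _]mulrC [_^-1 * gen_phase i]mulrC.
by rewrite -!scalerDr !ab !scalerA [gen_index j == _]eq_sym -scalerDl -mulrDl phaseC.
Qed.

Lemma hermitian_genK i v : hermitian_gen i (hermitian_gen i v) = v.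
Proof.
have := hermitian_gen_anticomm i i v; rewrite eqxx mulr1 -mulr2n -scaler_nat.
by apply: scalerI; rewrite pnatr_eq0.
Qed.

Lemma hermitian_genC i j v : i != j ->
  hermitian_gen i (hermitian_gen j v) = - hermitian_gen j (hermitian_gen i v).
Proof.
move=> ij; apply/eqP; rewrite -addr_eq0 hermitian_gen_anticomm (negbTE ij).
by rewrite mulr0 scale0r.
Qed.

End HermitianGenerators.

(** * The homomorphism from the classical Clifford algebra *)

Section DeformedCliffordMap.
Variables (R : realType) (n : nat) (theta : 'M[R]_n).
Local Notation C := R[i].
Local Notation Z := 'rV[int]_n.
Local Notation mat := 'M[C]_(2 ^ n).
Local Notation coc := (cocycle theta).
Local Notation dl mu := (delta_mx 0 mu : Z).
Variables G0 G : 'I_n -> mat.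
Hypothesis antisym : theta^T = - theta.
Hypothesis irrepG0 : cliff_irrep 0 G0.
Hypothesis irrepG : cliff_irrep theta G.

Let ann0 mu : {linear mat -> mat} := mulmx (G0 mu).
Let cre0 mu : {linear mat -> mat} := mulmx (adjmx (G0 mu)).
(** The degrees are chosen so that the phases of the torus cancel those of [G]. These are right
    multiplications because [clifford_map] turns right multiplication by a generator into its
    operator. *)
Let ann mu : {linear (Z -> mat) -> (Z -> mat)} := twist_mulr theta (G mu) (- dl mu).
Let cre mu : {linear (Z -> mat) -> (Z -> mat)} :=
  twist_mulr theta (adjmx (G mu)) (dl mu).

Lemma lam0 mu nu : lam (0 : 'M[R]_n) mu nu = 1.
Proof. by rewrite /lam mxE cos0 sin0. Qed.

Definition clifford_gen (i : 'I_n + 'I_n) : mat := hermitian_gen ann0 cre0 i 1%:M.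

Lemma mul_clifford_gen i X : clifford_gen i *m X = hermitian_gen ann0 cre0 i X.
Proof.
by rewrite /clifford_gen /hermitian_gen /= !mulmx1 mulmxDl -!scalemxAl.
Qed.

Let aa0 mu nu X : ann0 mu (ann0 nu X) + ann0 nu (ann0 mu X) = 0.
Proof.
have [H _ _ _] := irrepG0; have := H mu nu; rewrite lam0 scale1r => E.
by rewrite /= !mulmxA -mulmxDl E mul0mx.
Qed.

Let bb0 mu nu X : cre0 mu (cre0 nu X) + cre0 nu (cre0 mu X) = 0.
Proof.
have [_ H _ _] := irrepG0; have := H mu nu; rewrite lam0 scale1r => E.
by rewrite /= !mulmxA -mulmxDl E mul0mx.
Qed.

Let ab0 mu nu X : ann0 nu (cre0 mu X) + cre0 mu (ann0 nu X) = (mu == nu)%:R *: X.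
Proof.
have [_ _ H _] := irrepG0; have := H mu nu; rewrite lam0 scale1r => E.
by rewrite /= !mulmxA -mulmxDl addrC E mul_scalar_mx.
Qed.

Lemma clifford_genK i : clifford_gen i *m clifford_gen i = 1%:M.
Proof. by rewrite mul_clifford_gen; apply: hermitian_genK. Qed.

Lemma clifford_genC i j : i != j ->
  clifford_gen i *m clifford_gen j = - (clifford_gen j *m clifford_gen i).
Proof. by move=> ij; rewrite !mul_clifford_gen; apply: hermitian_genC. Qed.

Let cocC s t mu nu := cocycleC_delta antisym s t mu nu.

Let aa mu nu F : ann mu (ann nu F) + ann nu (ann mu F) = 0.
Proof.
(* Composing right multiplications reverses products, hence the relation with [nu] and [mu]
   exchanged; its zero is read as a scalar matrix. *)
have [H _ _ _] := irrepG; have := H nu mu; rewrite -[RHS](raddf0 (@scalar_mx _ _)).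
move=> /twist_mulr_anticomm /= ->; rewrite ?mulr0 ?scale0r ?eqxx //.
by rewrite -!scaleN1r cocC.
Qed.

Let bb mu nu F : cre mu (cre nu F) + cre nu (cre mu F) = 0.
Proof.
have [_ H _ _] := irrepG; have := H nu mu; rewrite -[RHS](raddf0 (@scalar_mx _ _)).
move=> /twist_mulr_anticomm /= ->; rewrite ?mulr0 ?scale0r ?eqxx //.
by rewrite -[dl mu]scale1r -[dl nu]scale1r cocC.
Qed.

Let ab mu nu F : ann nu (cre mu F) + cre mu (ann nu F) = (mu == nu)%:R *: F.
Proof.
have [_ _ H _] := irrepG; have := H mu nu.
move=> /twist_mulr_anticomm /= ->.
- have [->|_] := eqVneq mu nu; last by rewrite mulr0.
  by rewrite -[dl nu]scale1r -[- _]scaleN1r scalerA cocycle_delta ltnn mulr1.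
(* The two degrees have opposite signs, so the phase is the inverse of [lam theta nu mu], which is
   the [lam theta mu nu] of the relation. *)
- rewrite -[dl mu]scale1r -[- _]scaleN1r cocC (lamV antisym).
  by rewrite mulN1r exprN1 invrK.
- by have [->|_] := eqVneq mu nu; rewrite ?subrr ?eqxx.
Qed.

Definition unit_mode (M : mat) (k : Z) : Z -> mat := fun m => (m == k)%:R *: M.

(** The 2n hermitian generators satisfy the same relations on both sides, so their assignment
    extends. Writing [G0 mu] and its adjoint through them yields the two intertwining rules. *)
Lemma deformation_exists : exists Phi : mat -> (Z -> mat),
  [/\ linear Phi, Phi 1%:M = unit_mode 1%:M 0,
      forall X mu, Phi (X *m G0 mu) = twist_mulr theta (G mu) (- dl mu) (Phi X) &
      forall X mu, Phi (X *m adjmx (G0 mu)) =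
        twist_mulr theta (adjmx (G mu)) (dl mu) (Phi X)].
Proof.
have evenI : ~~ odd #|{: 'I_n + 'I_n}| by rewrite card_sum addnn odd_double.
have d0 : (0 < 2 ^ n)%N by rewrite expn_gt0.
have [Phi [PhiP Phi1 PhiM]] := clifford_map_exists clifford_genK clifford_genC
  (unit_mode 1%:M 0) (hermitian_genK aa bb ab) (hermitian_genC aa bb ab) evenI d0.
have Phi0 : Phi 0 = 0.
  by have := PhiP (-1) 0 0; rewrite scaler0 addr0 scaleN1r addNr.
have PhiZ c X : Phi (c *: X) = c *: Phi X.
  by rewrite -[c *: X]addr0 PhiP Phi0 addr0.
exists Phi; split=> // X mu.
  have -> : G0 mu = 2^-1 *: (clifford_gen (inl mu) + 'i%C *: clifford_gen (inr mu)).
    by rewrite -[LHS]mulmx1 -[LHS]/(ann0 mu 1%:M) (ann_hermitian ann0 cre0).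
  rewrite -scalemxAr mulmxDr -scalemxAr [X in _ *: X]addrC PhiZ PhiP.
  move: (PhiM X (inl mu)) (PhiM X (inr mu)).
  move: (clifford_gen (inl mu)) (clifford_gen (inr mu)) => g1 g2 -> ->.
  by rewrite [X in _ *: X]addrC; exact: (esym (ann_hermitian ann cre mu (Phi X))).
have -> : adjmx (G0 mu) =
    2^-1 *: (clifford_gen (inl mu) - 'i%C *: clifford_gen (inr mu)).
  by rewrite -[LHS]mulmx1 -[LHS]/(cre0 mu 1%:M) (cre_hermitian ann0 cre0).
rewrite -scaleNr -scalemxAr mulmxDr -scalemxAr [X in _ *: X]addrC PhiZ PhiP.
move: (PhiM X (inl mu)) (PhiM X (inr mu)).
move: (clifford_gen (inl mu)) (clifford_gen (inr mu)) => g1 g2 -> ->.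
rewrite [X in _ *: X]addrC scaleNr.
exact: (esym (cre_hermitian ann cre mu (Phi X))).
Qed.

End DeformedCliffordMap.

(** * The projection as a sum of elementary tensors *)

Section Letters.
Variables (R : realType) (n : nat).
Local Notation C := R[i].
Local Notation Z := 'rV[int]_n.
Local Notation mat := 'M[C]_(2 ^ n).

(** Indexes the 2n + 2 summands of the projection, each a matrix tensored with a form, so that
    products can be treated one summand at a time. *)
Definition letter : finType := (bool + ('I_n + 'I_n))%type.

Definition letter_case (T : Type) (one v : T) (u ustar : 'I_n -> T)
    (l : letter) : T :=
  match l with
  | inl true => one
  | inl false => v
  | inr (inl mu) => u mu
  | inr (inr mu) => ustar mu
  end.

Definition letter_mx (G : 'I_n -> mat) : letter -> mat :=
  letter_case 1%:M (chirality G) (fun mu => adjmx (G mu)) G.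

Definition letter_form : letter -> form R (n + n + 1) :=
  letter_case (@one0 R n) (@v0 R n) (@u0 R n) (fun mu => form_conj (u0 mu)).

(** The exponent of U in the summand, equal to the weight of its form under rotations. *)
Definition letter_deg : letter -> Z :=
  letter_case 0 0 (fun mu => delta_mx 0 mu) (fun mu => - delta_mx 0 mu).

Lemma projection_letters (V : lmodType C) (one v : V) (u ustar : 'I_n -> V) G i j :
  projection one u ustar v G i j =
    \sum_l (2^-1 * letter_mx G l i j) *: letter_case one v u ustar l.
Proof.
rewrite mxE; under [RHS]eq_bigr do rewrite -scalerA.
rewrite -scaler_sumr; congr (_ *: _); rewrite !big_sumType /= big_bool /= mxE.
by rewrite -big_split /= addrAC.
Qed.

Lemma classical_projection_letters G i j :
  classical_projection G i j = \sum_l (2^-1 * letter_mx G l i j) *: letter_form l.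
Proof. exact: projection_letters. Qed.

Lemma nc_projection_letters theta G i j : theta^T = - theta ->
  nc_projection theta G i j =
    \sum_l pure ((2^-1 * letter_mx G l i j) *: letter_form l) (letter_deg l).
Proof.
move=> antisym; rewrite [LHS]projection_letters; apply: eq_bigr => l _.
by rewrite pureZ; case: l => [[]|[mu|mu]] //=; rewrite nc_star_u.
Qed.

Lemma regular_letter_form l : regular_form (letter_form l).
Proof.
(* The radial extension of a coordinate function is y_i / |y|. *)
pose X (i : 'I_(n + n + 1)) : regular_expr R _ := RegInvnorm (RegCoord i (RegOne R _)).
have XE i y (x : sphere R (n + n + 1)) : val x = invnorm y *: y ->
    (val x 0 i)%:C = reg_eval (X i) y.
  by move=> ->; rewrite mxE /= mulr1 rmorphM.
pose re mu : 'I_(n + n + 1) := lshift 1 (lshift n mu).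
pose im mu : 'I_(n + n + 1) := lshift 1 (rshift n mu).
case: l => [[]|[mu|mu]] /=.
- by apply: (@regular_form_fun _ _ _ (RegOne R _)).
- by apply: (@regular_form_fun _ _ _ (X (rshift (n + n) 0))) => y x _ /XE.
- apply: (@regular_form_fun _ _ _ (RegAdd (X (re mu)) (RegScale 'i%C (X (im mu))))).
  move=> y x _ ex.
  rewrite -[RHS]/(reg_eval (X (re mu)) y + 'i%C * reg_eval (X (im mu)) y).
  by rewrite -!(XE _ _ _ ex); simpc.
have -> : form_conj (@u0 R n mu) = form_fun (fun x => (val x 0 (re mu))
    -i* (val x 0 (im mu))).
  apply/funext => x; apply/funext => S.
  by rewrite /form_conj /u0 /form_fun /ext_one rmorphM rmorph_nat.
apply: (@regular_form_fun _ _ _ (RegAdd (X (re mu)) (RegScale (- 'i%C) (X (im mu))))).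
move=> y x _ ex.
rewrite -[RHS]/(reg_eval (X (re mu)) y + (- 'i%C) * reg_eval (X (im mu)) y).
by rewrite -!(XE _ _ _ ex); simpc.
Qed.

Lemma form_d_classical_projection G i j :
  form_d (classical_projection G i j) =
    \sum_l (2^-1 * letter_mx G l i j) *: form_d (letter_form l).
Proof.
rewrite classical_projection_letters form_d_sum => [|l].
  by apply: eq_bigr => l _; rewrite form_dZ //; exact: regular_letter_form.
by apply/regular_formZ/regular_letter_form.
Qed.

Lemma nc_form_sumE (I : Type) (r : seq I) (F : I -> nc_form R n) m :
  (\sum_(i <- r) F i) m = \sum_(i <- r) F i m.
Proof. by elim: r => [|i r IH]; rewrite ?big_nil // !big_cons -IH. Qed.

Lemma regular_pure (w : form R (n + n + 1)) (k m : Z) :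
  regular_form w -> regular_form (pure w k m).
Proof. by rewrite /pure; case: eqP => // _ _; exact: regular_form0. Qed.

Lemma nc_d_nc_projection theta G i j : theta^T = - theta ->
  nc_d (nc_projection theta G i j) =
    \sum_l pure ((2^-1 * letter_mx G l i j) *: form_d (letter_form l))
      (letter_deg l).
Proof.
move=> antisym; rewrite nc_projection_letters //; apply/funext => m.
rewrite /nc_d !nc_form_sumE form_d_sum => [|l].
  apply: eq_bigr => l _; rewrite /pure; case: ifP => _; last exact: form_d0.
  by rewrite form_dZ //; exact: regular_letter_form.
exact/regular_pure/regular_formZ/regular_letter_form.
Qed.

End Letters.

(** * Transport of self-duality to the deformed projection *)

Section Deformation.
Variables (R : realType) (n : nat) (theta : 'M[R]_n).
Local Notation C := R[i].
Local Notation Z := 'rV[int]_n.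
Local Notation mat := 'M[C]_(2 ^ n).
Local Notation coc := (cocycle theta).
Local Notation formN := (form R (n + n + 1)).
Variables (G0 G : 'I_n -> mat) (Phi : mat -> (Z -> mat)).
Hypothesis antisym : theta^T = - theta.
Hypothesis PhiP : linear Phi.
Hypothesis Phi1 : Phi 1%:M = unit_mode 1%:M 0.
Hypothesis Phi_ann : forall X mu,
  Phi (X *m G0 mu) = twist_mulr theta (G mu) (- delta_mx 0 mu) (Phi X).
Hypothesis Phi_cre : forall X mu,
  Phi (X *m adjmx (G0 mu)) = twist_mulr theta (adjmx (G mu)) (delta_mx 0 mu) (Phi X).

Let Phi0 : Phi 0 = 0.
Proof. by have := PhiP (-1) 0 0; rewrite scaler0 addr0 scaleN1r addNr. Qed.

Let PhiZ c X : Phi (c *: X) = c *: Phi X.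
Proof. by rewrite -[c *: X]addr0 PhiP Phi0 addr0. Qed.

Let PhiD X Y : Phi (X + Y) = Phi X + Phi Y.
Proof. by have := PhiP 1 X Y; rewrite !scale1r. Qed.

(** [G mu] and its adjoint carry opposite degrees, so every commutator, and with it the chirality,
    has degree 0. *)
Lemma Phi_chirality X :
  Phi (X *m chirality G0) = twist_mulr theta (chirality G) 0 (Phi X).
Proof.
(* Quantifying over [X] makes this relation stable under products. *)
pose K (A B : mat) := forall X, Phi (X *m A) = twist_mulr theta B 0 (Phi X).
suff : K (chirality G0) (chirality G) by apply.
apply: (big_ind2 K) => [Y|A A' B B' HA HB Y|mu _ Y].
- by rewrite mulmx1 twist_mulr1.
- by rewrite mulmxA HB HA twist_mulrA cocycle0l scale1r addr0.
- have coc1 s t : coc (s *: delta_mx 0 mu) (t *: delta_mx 0 mu) = 1.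
    by rewrite cocycle_delta ltnn.
  have coc2 : coc (- delta_mx 0 mu) (delta_mx 0 mu) = 1.
    by rewrite -(coc1 (-1) 1) scaleN1r scale1r.
  have coc3 : coc (delta_mx 0 mu) (- delta_mx 0 mu) = 1.
    by rewrite -(coc1 1 (-1)) scaleN1r scale1r.
  rewrite mulmxBr !mulmxA addrC -scaleN1r PhiP !(Phi_ann, Phi_cre).
  rewrite !twist_mulrA coc2 coc3 subrr addNr !scale1r -twist_mulrP.
  by rewrite scaleN1r addrC.
Qed.

Lemma Phi_letter X l : Phi (X *m letter_mx G0 l) =
  twist_mulr theta (letter_mx G l) (letter_deg l) (Phi X).
Proof.
case: l => [[]|[mu|mu]] /=.
- by rewrite mulmx1 twist_mulr1.
- exact: Phi_chirality.
- exact: Phi_cre.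
- exact: Phi_ann.
Qed.

Lemma Phi_delta X m i j :
  Phi X m i j = \sum_k \sum_l X k l * Phi (delta_mx k l) m i j.
Proof.
rewrite {1}(matrix_sum_delta X) (big_morph Phi PhiD Phi0) fct_sumE summxE.
apply: eq_bigr => k _; rewrite (big_morph Phi PhiD Phi0) fct_sumE summxE.
by apply: eq_bigr => l _; rewrite PhiZ mxE.
Qed.

(* Phi (x) id on M_(2^n)(C) (x) forms *)
Definition Psi (A : 'M[formN]_(2 ^ n)) : 'M[nc_form R n]_(2 ^ n) :=
  \matrix_(i, j) ((fun m => \sum_k \sum_l Phi (delta_mx k l) m i j *: A k l)
    : nc_form R n).

(** [Psi] is defined through matrix units; linearity of [Phi] lets it be computed from any
    expression of [A] by matrices tensored with forms. *)
Lemma Psi_tensor (L : finType) (g : L -> mat) (w : L -> formN)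
    (A : 'M[formN]_(2 ^ n)) i j m :
    (forall k l, A k l = \sum_a g a k l *: w a) ->
  Psi A i j m = \sum_a Phi (g a) m i j *: w a.
Proof.
move=> AE; rewrite mxE.
under eq_bigr => k _ do under eq_bigr => l _ do rewrite AE scaler_sumr.
under eq_bigr => k _ do rewrite exchange_big /=.
rewrite exchange_big /=; apply: eq_bigr => a _.
rewrite Phi_delta scaler_suml; apply: eq_bigr => k _.
rewrite scaler_suml; apply: eq_bigr => l _.
by rewrite scalerA mulrC.
Qed.

(** By [Phi_letter] at X = 1, [Phi] sends the matrix of each letter to its deformed matrix, placed
    in the mode [letter_deg l]. *)
Lemma Psi_projection : Psi (classical_projection G0) = nc_projection theta G.
Proof.
apply/matrixP => i j; apply/funext => m.
rewrite nc_projection_letters // nc_form_sumE.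
rewrite (@Psi_tensor _ (fun l => 2^-1 *: letter_mx G0 l) (@letter_form R n)); last first.
  move=> k l; rewrite classical_projection_letters.
  by apply: eq_bigr => a _; rewrite mxE.
apply: eq_bigr => l _.
rewrite PhiZ -[letter_mx G0 l]mul1mx Phi_letter Phi1 mxE /twist_mulr /unit_mode.
rewrite subr_eq0 /pure; have [->|_] := eqVneq.
  by rewrite subrr cocycle0l !scale1r mul1mx.
by rewrite scale0r mul0mx scaler0 mxE mulr0 scale0r.
Qed.

Lemma form_mul_suml (I : Type) (r : seq I) (F : I -> formN) w :
  form_mul (\sum_(i <- r) F i) w = \sum_(i <- r) form_mul (F i) w.
Proof.
elim: r => [|i r IH].
  rewrite !big_nil -[X in form_mul X](addrN (0 : formN)) -scaleN1r addrC.
  by rewrite form_mulPl scaleN1r addNr.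
by rewrite !big_cons -[F i]scale1r form_mulPl IH !scale1r.
Qed.

Lemma form_mulZl c w w' : form_mul (c *: w) w' = c *: form_mul w w' :> formN.
Proof.
have := form_mul_suml [::] (fun _ : 'I_0 => 0) w'; rewrite !big_nil => E.
by rewrite -[c *: w]addr0 form_mulPl E addr0.
Qed.

(** The right factor is a sum over letters, so [Phi_letter] applies termwise. Since [A] is
    arbitrary, the identity can be iterated. *)
Lemma Psi_mul A :
  Psi (mx_mul (@form_mul R _) A (map_mx (@form_d R _) (classical_projection G0))) =
  mx_mul (nc_mul theta) (Psi A) (map_mx (@nc_d R n) (nc_projection theta G)).
Proof.
apply/matrixP => i j; apply/funext => m; rewrite [in RHS]mxE nc_form_sumE.
(* With matrix units E_qp, the product is the sum over q, p and letters a of (1/2) E_qp M_a tensored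
   with the form A_qp /\ d w_a, where M_a and w_a belong to the letter a. *)
pose w (a : 'I_(2 ^ n) * 'I_(2 ^ n) * letter n) :=
  form_mul (A a.1.1 a.1.2) (form_d (@letter_form R n a.2)).
have triple (F : 'I_(2 ^ n) * 'I_(2 ^ n) * letter n -> formN) :
    \sum_b F b = \sum_q \sum_p \sum_a F (q, p, a).
  by rewrite pair_bigA pair_bigA; apply: eq_bigr => -[[q p] a].
rewrite (@Psi_tensor _
  (fun a => 2^-1 *: (delta_mx a.1.1 a.1.2 *m letter_mx G0 a.2)) w); last first.
  move=> k l; rewrite mxE triple.
  rewrite [RHS](bigD1 k) //= [X in _ + X]big1 ?addr0 => [|q qk]; last first.
    rewrite big1 // => p _; rewrite big1 // => a _.
    rewrite !mxE big1 ?mulr0 ?scale0r // => r _.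
    by rewrite mxE eq_sym (negbTE qk) mul0r.
  apply: eq_bigr => p _; rewrite mxE form_d_classical_projection linear_sum.
  apply: eq_bigr => a _; rewrite linearZ; congr (_ *: _).
  rewrite !mxE (bigD1 p) //= big1 ?addr0 => [|r rp].
    by rewrite mxE !eqxx mul1r.
  by rewrite mxE (negbTE rp) andbF mul0r.
under [RHS]eq_bigr => r _.
  rewrite [X in nc_mul _ _ X]mxE nc_d_nc_projection // nc_mul_sum_pure.
  over.
(* Both sides become sums over a, q, p of scalars times the same forms; the equality of scalars is
   [Phi_letter] at X = E_qp. *)
rewrite triple. under [LHS]eq_bigr do rewrite exchange_big.
rewrite [LHS]exchange_big.
rewrite [RHS]exchange_big; apply: eq_bigr => a _ /=.
under [RHS]eq_bigr => r _.
  rewrite linearZ mxE /= form_mul_suml !scaler_sumr.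
  under eq_bigr => q _.
    rewrite form_mul_suml !scaler_sumr.
    under eq_bigr => p _ do rewrite form_mulZl !scalerA.
    over.
  over.
rewrite [RHS]exchange_big; apply: eq_bigr => q _ /=.
rewrite [RHS]exchange_big; apply: eq_bigr => p _ /=.
rewrite -scaler_suml; congr (_ *: _).
rewrite PhiZ Phi_letter /twist_mulr !mxE !mulr_sumr.
by apply: eq_bigr => r _; ring.
Qed.


Lemma Psi_hodge o A : map_mx (@nc_hodge R n o) (Psi A) = Psi (map_mx (form_hodge o) A).
Proof.
apply/matrixP => i j; apply/funext => m; rewrite !mxE /nc_hodge linear_sum.
apply: eq_bigr => k _; rewrite linear_sum; apply: eq_bigr => l _.
by rewrite linearZ mxE.
Qed.

Lemma Psi_scale (c : C) A : map_mx ( *:%R c) (Psi A) = Psi (map_mx ( *:%R c) A).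
Proof.
apply/matrixP => i j; apply/funext => m; rewrite !mxE.
rewrite -[LHS]/(c *: (\sum_k \sum_l Phi (delta_mx k l) m i j *: A k l)).
rewrite scaler_sumr; apply: eq_bigr => k _; rewrite scaler_sumr.
by apply: eq_bigr => l _; rewrite mxE !scalerA mulrC.
Qed.

Lemma nc_self_dual_deformation o : classical_self_dual o G0 -> nc_self_dual theta o G.
Proof.
rewrite /classical_self_dual /nc_self_dual /self_dual => ho.
have -> : e_de_n (nc_mul theta) (@nc_d R n) (nc_projection theta G) =
    Psi (e_de_n (@form_mul R _) (@form_d R _) (classical_projection G0)).
  (* Factors are appended on the right, so [Psi_mul] is the induction step. *)
  have iterE k : iter k (fun A => mx_mul (nc_mul theta) A
        (map_mx (@nc_d R n) (nc_projection theta G))) (nc_projection theta G) =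
      Psi (iter k (fun A => mx_mul (@form_mul R _) A
        (map_mx (@form_d R _) (classical_projection G0))) (classical_projection G0)).
    by elim: k => [|k IH]; [rewrite Psi_projection | rewrite !iterS IH Psi_mul].
  exact: iterE.
by rewrite Psi_hodge ho -Psi_scale.
Qed.

End Deformation.
(** * Torus invariance and smoothness of the projection *)

Section TorusAction.
Variables (R : realType) (n : nat).
Local Notation N := (n + n + 1)%N.
Local Notation re mu := (lshift 1 (lshift n mu)).
Local Notation im mu := (lshift 1 (rshift n mu)).
Implicit Types (s : 'rV[R]_n) (x : 'rV[R]_N) (mu : 'I_n).

Lemma mul_rotation x s : x *m rotation s =
  row_mx (row_mx
    (\row_mu (x 0 (re mu) * cos (2 * pi * s 0 mu) - x 0 (im mu) * sin (2 * pi * s 0 mu)))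
    (\row_mu (x 0 (re mu) * sin (2 * pi * s 0 mu) + x 0 (im mu) * cos (2 * pi * s 0 mu))))
    (rsubmx x).
Proof.
rewrite -[x in LHS]hsubmxK -[lsubmx x]hsubmxK /rotation !mul_row_block.
rewrite !mulmx0 add0r addr0 mulmx1 mulmxN !mul_mx_diag.
by congr (row_mx (row_mx _ _) _); apply/rowP => mu; rewrite !mxE.
Qed.

Lemma sqnorm_coords x : sqnorm x =
  \sum_mu (x 0 (re mu) ^+ 2 + x 0 (im mu) ^+ 2) + x 0 (rshift (n + n) 0) ^+ 2.
Proof. by rewrite /sqnorm !big_split_ord /= big_ord1 big_split. Qed.

Lemma sqnorm_rotation x s : sqnorm (x *m rotation s) = sqnorm x.
Proof.
rewrite mul_rotation !sqnorm_coords; congr (_ + _).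
  apply: eq_bigr => mu _; rewrite !row_mxEl row_mxEr !mxE.
  have := cos2Dsin2 (2 * pi * s 0 mu); move: (cos _) (sin _) => c z cz.
  rewrite -[RHS]mul1r -cz; ring.
by rewrite row_mxEr mxE.
Qed.

Definition rotate s (x : sphere R N) : sphere R N :=
  Sub (val x *m rotation s)
    (etrans (congr1 (eq_op^~ 1) (sqnorm_rotation (val x) s)) (valP x)).

(** The character e^(-2 i pi k.s) by which tau_(-s) acts on U^k. *)
Definition torus_phase s (k : 'rV[int]_n) : R[i] :=
  let t := - (2 * pi * \sum_(mu < n) (k 0 mu)%:~R * s 0 mu) in cos t +i* sin t.

Lemma torus_phase_delta s mu : torus_phase s (delta_mx 0 mu) =
  cos (2 * pi * s 0 mu) -i* sin (2 * pi * s 0 mu).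
Proof.
rewrite /torus_phase (bigD1 mu) //= big1 => [|nu /negbTE E]; last first.
  by rewrite mxE E andbF mul0r.
by rewrite mxE !eqxx mul1r addr0 cosN sinN.
Qed.

Lemma torus_phase_deltaN s mu : torus_phase s (- delta_mx 0 mu) =
  cos (2 * pi * s 0 mu) +i* sin (2 * pi * s 0 mu).
Proof.
rewrite /torus_phase (bigD1 mu) //= big1 => [|nu /negbTE E]; last first.
  by rewrite !mxE E andbF oppr0 mul0r.
by rewrite !mxE !eqxx mulN1r addr0 mulrN opprK.
Qed.

Lemma torus_phase0 s : torus_phase s 0 = 1.
Proof.
rewrite /torus_phase big1 => [|mu _]; last by rewrite mxE mul0r.
by rewrite mulr0 oppr0 cos0 sin0.
Qed.

(** Rotation multiplies the form of a letter by a character, whose inverse is the phase attached to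
    its degree. *)
Lemma letter_form_rotate s l :
  torus_phase s (letter_deg l) *: form_pull (rotation s) (@letter_form R n l) =
    @letter_form R n l.
Proof.
have pull (f : sphere R N -> R[i]) k :
    (forall x : sphere R N, torus_phase s k * f (rotate s x) = f x) ->
    torus_phase s k *: form_pull (rotation s) (form_fun f) = form_fun f :> form R N.
  move=> fE; apply/funext => x; apply/funext => S.
  rewrite -[LHS]/(torus_phase s k * form_pull (rotation s) (form_fun f) x S).
  rewrite (@form_pull_form_fun _ _ _ _ _ (rotate s x)) //.
  by rewrite /form_fun -[f x]fE mulrA.
have conj_u0 mu : form_conj (@u0 R n mu) =
    form_fun (fun x : sphere R N => val x 0 (re mu) -i* val x 0 (im mu)).
  apply/funext => x; apply/funext => S.
  by rewrite /form_conj /u0 /form_fun /ext_one rmorphM rmorph_nat.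
case: l => [[]|[mu|mu]]; rewrite /letter_deg /letter_form /= ?conj_u0;
  apply: pull => x; rewrite /= ?mul_rotation.
- by rewrite torus_phase0 mul1r.
- by rewrite torus_phase0 mul1r row_mxEr mxE.
- rewrite !row_mxEl row_mxEr torus_phase_delta !mxE.
  (* Real and imaginary parts become polynomial identities once the right-hand side is multiplied by
     1 = c^2 + z^2. *)
  have := cos2Dsin2 (2 * pi * s 0 mu); move: (cos _) (sin _) => c z cz.
  move: (sval x 0 (re mu)) (sval x 0 (im mu)) => {x}p r.
  apply/eqP; rewrite eq_complex /=; apply/andP; split; apply/eqP.
    rewrite -[RHS]mul1r -cz; ring.
  rewrite -[RHS]mul1r -cz; ring.
- rewrite !row_mxEl row_mxEr torus_phase_deltaN !mxE.
  have := cos2Dsin2 (2 * pi * s 0 mu); move: (cos _) (sin _) => c z cz.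
  move: (sval x 0 (re mu)) (sval x 0 (im mu)) => {x}p r.
  apply/eqP; rewrite eq_complex /=; apply/andP; split; apply/eqP.
    rewrite -[RHS]mul1r -cz; ring.
  rewrite -[RHS]mul1r -cz; ring.
Qed.

End TorusAction.

(** * The entries of the projection as deformed functions *)

Section Omega0.
Variables (R : realType) (n : nat) (theta : 'M[R]_n).
Variable G : 'I_n -> 'M[R[i]]_(2 ^ n).
Hypothesis antisym : theta^T = - theta.

Let e := nc_projection theta G.

Lemma of_degree_letter_form l : of_degree 0 (@letter_form R n l).
Proof.
case: l => [[]|[mu|mu]]; try exact: of_degree_form_fun.
move=> x S S0; rewrite /= /form_conj /u0 of_degree_form_fun //.
exact: conjc0.
Qed.

Lemma nc_projection_coef i j m : e i j m =
  \sum_l pure ((2^-1 * letter_mx G l i j) *: @letter_form R n l) (letter_deg l) m.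
Proof. by rewrite /e nc_projection_letters // nc_form_sumE. Qed.

Lemma regular_nc_projection i j m : regular_form (e i j m).
Proof.
rewrite nc_projection_coef; apply: regular_form_sum => l.
exact/regular_pure/regular_formZ/regular_letter_form.
Qed.

Lemma of_degree_nc_projection i j m : of_degree 0 (e i j m).
Proof.
move=> x S S0; rewrite nc_projection_coef !fct_sumE big1 // => l _.
by rewrite /pure; case: ifP => // _; rewrite !fctE of_degree_letter_form ?scaler0.
Qed.

Lemma nc_projection_supp i j m : m \notin codom (@letter_deg n) -> e i j m = 0.
Proof.
move=> mn; rewrite nc_projection_coef big1 // => l _; rewrite /pure.
by case: eqP => // E; rewrite E codom_f in mn.
Qed.

Lemma partials_cst0 N s : partials s (fun=> 0 : R[i]) = (fun=> 0) :> ('rV[R]_N -> R[i]).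
Proof. by elim: s => //= i s ->; apply/funext => y; rewrite partial_cst. Qed.

(** Only the finitely many degrees of letters occur, each with a regular coefficient, so rapid decay
    reduces to finitely many bounds. *)
Lemma nc_projection_tensor_hat i j : tensor_hat (e i j).
Proof.
split=> [k|S s q].
  apply: regular_form_smooth; first exact: of_degree_nc_projection.
  exact: regular_nc_projection.
have bounded l : exists B : R[i], 0 <= B /\ forall x : sphere R (n + n + 1),
    `|partials s (fun y => radial (e i j (@letter_deg n l)) y S) (val x)| <= B.
  have [B B0 HB] := regular_form_bounded S s (regular_nc_projection i j (letter_deg l)).
  by exists B.
have /choice[B BP] := bounded.
pose wt (k : 'rV[int]_n) : R[i] := (1 + \sum_(mu < n) `|k 0 mu|)%:~R ^+ q.
have wt0 k : 0 <= wt k.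
  by rewrite exprn_ge0 // ler0z addr_ge0 // sumr_ge0.
(* All terms are nonnegative, so this sum dominates the term of every mode that occurs. *)
exists (\sum_l B l * wt (letter_deg l)) => k x; rewrite -/(wt k).
have [/codomP[l ->]|/nc_projection_supp ->] := boolP (k \in codom (@letter_deg n)).
  have [Bl0 HB] := BP l; rewrite (bigD1 l) //= -[leLHS]addr0 lerD //.
    by rewrite ler_wpM2r ?wt0 ?HB.
  by apply: sumr_ge0 => l' _; rewrite mulr_ge0 //; case: (BP l').
rewrite (_ : (fun y => _) = fun=> 0); last by apply/funext => y; rewrite radial0.
rewrite partials_cst0 normr0 mul0r.
by apply: sumr_ge0 => l' _; rewrite mulr_ge0 //; case: (BP l').
Qed.

Lemma nc_projection_torus_act s i j : torus_act s (e i j) = e i j.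
Proof.
apply/funext => k; rewrite /torus_act -/(torus_phase s k) nc_projection_coef.
rewrite linear_sum scaler_sumr; apply: eq_bigr => l _.
rewrite /pure; case: eqP => [->|_]; last by rewrite linear0 scaler0.
rewrite linearZ /= scalerA mulrC -[in LHS]scalerA.
by rewrite letter_form_rotate.
Qed.

End Omega0.

Theorem theorem7 (R : realType) (n : nat) (theta : 'M[R]_n)
    (G0 G : 'I_n -> 'M[R[i]]_(2 ^ n)) (o : bool)
    (hn : (2 <= n)%N)
    (htheta : theta^T = - theta)
    (hG0 : cliff_irrep 0 G0)
    (hG : cliff_irrep theta G)
    (ho : classical_self_dual o G0) :
  (forall i j, Omega 0 (nc_projection theta G i j)) /\
  nc_self_dual theta o G.
Proof.
split=> [i j|].
  split; first exact: nc_projection_tensor_hat.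
    by move=> s; exact: nc_projection_torus_act.
  by move=> k; exact: of_degree_nc_projection.
have [Phi [PhiP Phi1 Phi_ann Phi_cre]] := deformation_exists htheta hG0 hG.
exact: (nc_self_dual_deformation htheta PhiP Phi1 Phi_ann Phi_cre).
Qed.
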